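(* Let $x_1,x_2,y_1,y_2,u_1,u_2,v_1,v_2,w_{\rm e},w_{\rm o},z_{\rm e},z_{\rm o},p_{-1},p_{-2},p_{+1},p_{+2},q_{-1},q_{-2},q_{+1},q_{+2},s_{\rm e},s_{\rm o},\lambda$ be commuting indeterminates and for $n\ge0$ let \[ \widehat{P}_n=\sum_{\sigma\in\mathfrak{D}_{2n}}x_1^{\mathrm{eareccpeak}}x_2^{\mathrm{eareccdfall}}y_1^{\mathrm{ereccval}}y_2^{\mathrm{ereccdrise}}u_1^{\mathrm{nrcpeak}}u_2^{\mathrm{nrcdfall}}v_1^{\mathrm{nrcval}}v_2^{\mathrm{nrcdrise}}w_{\rm e}^{\mathrm{evennrfix}}w_{\rm o}^{\mathrm{oddnrfix}}z_{\rm e}^{\mathrm{evenrar}}z_{\rm o}^{\mathrm{oddrar}} p_{-1}^{\mathrm{lcrosscpeak}}p_{-2}^{\mathrm{lcrosscdfall}}p_{+1}^{\mathrm{ucrosscval}}p_{+2}^{\mathrm{ucrosscdrise}}q_{-1}^{\mathrm{lnestcpeak}}q_{-2}^{\mathrm{lnestcdfall}}q_{+1}^{\mathrm{unestcval}}q_{+2}^{\mathrm{unestcdrise}}s_{\rm e}^{\mathrm{epsnest}}s_{\rm o}^{\mathrm{opsnest}}\lambda^{\mathrm{cyc}}, \] all statistics evaluated at $\sigma$. Under the specialisation $v_1=y_1$ and $q_{+1}=p_{+1}$, \[ \sum_{n\ge0}\widehat{P}_n\,t^n=\cfrac{1}{1-\delta_1t-\cfrac{\alpha_1t}{1-\delta_2t-\cfrac{\alpha_2t}{1-\cdots}}}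 \] as formal power series in $t$, where for $k\ge1$: $\alpha_{2k-1}=(\lambda+k-1)\,p_{+1}^{k-1}y_1\big(p_{-1}^{k-1}x_1+q_{-1}[k-1]_{p_{-1},q_{-1}}u_1\big)$, $\alpha_{2k}=\big(p_{-2}^{k-1}x_2+q_{-2}[k-1]_{p_{-2},q_{-2}}u_2+\lambda s_{\rm e}^kw_{\rm e}\big)\big(p_{+2}^{k-1}y_2+q_{+2}[k-1]_{p_{+2},q_{+2}}v_2+\lambda s_{\rm o}^kw_{\rm o}\big)$, and $\delta_1=\lambda^2z_{\rm e}z_{\rm o}$, $\delta_n=0$ for $n\ge2$.
   Context: A D-permutation of $[2n]$ is a permutation with $\sigma(2k-1)\ge2k-1$ and $\sigma(2k)\le2k$ for all $k$; $\mathfrak{D}_{2n}$ is their set. For a permutation $\sigma$: index $i$ is a cycle peak if $\sigma^{-1}(i)<i>\sigma(i)$, cycle valley if $\sigma^{-1}(i)>i<\sigma(i)$, cycle double rise if $\sigma^{-1}(i)<i<\sigma(i)$, cycle double fall if $\sigma^{-1}(i)>i>\sigma(i)$, fixed point if $\sigma(i)=i$. Record: $\sigma(j)<\sigma(i)$ for all $j<i$; antirecord: $\sigma(j)>\sigma(i)$ for all $j>i$; exclusive record/antirecord = one but not the other; record-antirecord = both. $\mathrm{eareccpeak},\mathrm{eareccdfall}$ count cycle peaks, double falls that are exclusive antirecords; $\mathrm{ereccval},\mathrm{ereccdrise}$ count cycle valleys, double rises that are exclusive records; $\mathrm{nrcpeak},\mathrm{nrcdfall},\mathrm{nrcval},\mathrm{nrcdrise}$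 count cycle peaks, double falls, valleys, double rises that are neither records nor antirecords; $\mathrm{evennrfix}$ ($\mathrm{oddnrfix}$) counts even (odd) fixed points that are neither records nor antirecords; $\mathrm{evenrar}$ ($\mathrm{oddrar}$) counts even (odd) record-antirecords. $\mathrm{cyc}$ = number of cycles. $\mathrm{ucross}(j,\sigma)=\#\{(i,k,l):i<j<k<l,\ k=\sigma(i),\ l=\sigma(j)\}$, $\mathrm{unest}(j,\sigma)=\#\{(i,k,l):i<j<k<l,\ k=\sigma(j),\ l=\sigma(i)\}$, $\mathrm{lcross}(k,\sigma)=\#\{(i,j,l):i<j<k<l,\ i=\sigma(k),\ j=\sigma(l)\}$, $\mathrm{lnest}(k,\sigma)=\#\{(i,j,l):i<j<k<l,\ i=\sigma(l),\ j=\sigma(k)\}$. $\mathrm{ucrosscval}$ ($\mathrm{ucrosscdrise}$) is the sum of $\mathrm{ucross}(j,\sigma)$ over cycle valleys (cycle double rises) $j$, $\mathrm{unestcval},\mathrm{unestcdrise}$ likewise with $\mathrm{unest}$; $\mathrm{lcrosscpeak}$ ($\mathrm{lcrosscdfall}$) is the sum of $\mathrm{lcross}(k,\sigma)$ over cycle peaks (cycle double falls) $k$, $\mathrm{lnestcpeak},\mathrm{lnestcdfall}$ likewise with $\mathrm{lnest}$. For a fixed point $i$, $\mathrm{psnest}(i,\sigma)=\#\{j<i:\sigma(j)>i\}$; $\mathrm{epsnest}(\sigma)$ ($\mathrm{opsnest}(\sigma)$) is the sum of $\mathrm{psnest}(i,\sigma)$ over even (odd) fixed points $i$. $[m]_{p,q}=\sum_{j=0}^{m-1}p^{m-1-j}q^j$.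 *)

(* Defs.v *)
From HB Require Import structures.
From mathcomp Require Import all_boot all_order all_algebra all_fingroup.

Set Implicit Arguments.
Unset Strict Implicit.
Unset Printing Implicit Defensive.

Import GRing.Theory.
Local Open Scope ring_scope.

(* The set [N] = {1, ..., N} is encoded by 'I_N: the ordinal with value i
   stands for the index i + 1.  Comparisons of indices are unaffected by this
   shift, parities are not; they are always taken on the shifted value. *)
Definition even_index N (i : 'I_N) : bool := ~~ odd i.+1.
Definition odd_index N (i : 'I_N) : bool := odd i.+1.

Definition Dperm n (s : 'S_(n.*2)) : bool :=
  [forall i, if odd_index i then (i <= s i)%N else (s i <= i)%N].

Section Statistics.
Variables (N : nat) (s : 'S_N).
Implicit Types i j k l : 'I_N.
Local Open Scope nat_scope.

Definition cpeak i : bool := ((s^-1)%g i < i) && (s i < i).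
Definition cval i : bool := (i < (s^-1)%g i) && (i < s i).
Definition cdrise i : bool := ((s^-1)%g i < i) && (i < s i).
Definition cdfall i : bool := (i < (s^-1)%g i) && (s i < i).
Definition fix_index i : bool := s i == i.

Definition record i : bool := [forall j : 'I_N, (j < i) ==> (s j < s i)].
Definition antirecord i : bool := [forall j : 'I_N, (i < j) ==> (s i < s j)].
Definition erec i : bool := record i && ~~ antirecord i.
Definition earec i : bool := antirecord i && ~~ record i.
Definition rar i : bool := record i && antirecord i.
Definition nrar i : bool := ~~ record i && ~~ antirecord i.

Definition eareccpeak : nat := #|[set i | cpeak i && earec i]|.
Definition eareccdfall : nat := #|[set i | cdfall i && earec i]|.
Definition ereccval : nat := #|[set i | cval i && erec i]|.
Definition ereccdrise : nat := #|[set i | cdrise i && erec i]|.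
Definition nrcpeak : nat := #|[set i | cpeak i && nrar i]|.
Definition nrcdfall : nat := #|[set i | cdfall i && nrar i]|.
Definition nrcval : nat := #|[set i | cval i && nrar i]|.
Definition nrcdrise : nat := #|[set i | cdrise i && nrar i]|.
Definition evennrfix : nat :=
  #|[set i | [&& even_index i, fix_index i & nrar i]]|.
Definition oddnrfix : nat :=
  #|[set i | [&& odd_index i, fix_index i & nrar i]]|.
Definition evenrar : nat := #|[set i | even_index i && rar i]|.
Definition oddrar : nat := #|[set i | odd_index i && rar i]|.

Definition cyc : nat := #|porbits s|.

Definition ucross j : nat :=
  #|[set t : 'I_N * 'I_N * 'I_N | let: (i, k, l) := t in
      [&& i < j, j < k, k < l, k == s i & l == s j]]|.
Definition unest j : nat :=
  #|[set t : 'I_N * 'I_N * 'I_N | let: (i, k, l) := t in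
      [&& i < j, j < k, k < l, k == s j & l == s i]]|.
Definition lcross k : nat :=
  #|[set t : 'I_N * 'I_N * 'I_N | let: (i, j, l) := t in
      [&& i < j, j < k, k < l, i == s k & j == s l]]|.
Definition lnest k : nat :=
  #|[set t : 'I_N * 'I_N * 'I_N | let: (i, j, l) := t in
      [&& i < j, j < k, k < l, i == s l & j == s k]]|.
Definition psnest i : nat := #|[set j : 'I_N | (j < i) && (i < s j)]|.

Definition ucrosscval : nat := \sum_(j | cval j) ucross j.
Definition ucrosscdrise : nat := \sum_(j | cdrise j) ucross j.
Definition unestcval : nat := \sum_(j | cval j) unest j.
Definition unestcdrise : nat := \sum_(j | cdrise j) unest j.
Definition lcrosscpeak : nat := \sum_(k | cpeak k) lcross k.
Definition lcrosscdfall : nat := \sum_(k | cdfall k) lcross k.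
Definition lnestcpeak : nat := \sum_(k | cpeak k) lnest k.
Definition lnestcdfall : nat := \sum_(k | cdfall k) lnest k.
Definition epsnest : nat := \sum_(i | even_index i && fix_index i) psnest i.
Definition opsnest : nat := \sum_(i | odd_index i && fix_index i) psnest i.

End Statistics.

(* In the names of the variables, m stands for the index sign "-" and p for
   "+": pm1 is p_{-1}, pp1 is p_{+1}, and so on; lam is lambda. *)
Definition Phat (R : comNzRingType)
    (x1 x2 y1 y2 u1 u2 v1 v2 we wo ze zo
     pm1 pm2 pp1 pp2 qm1 qm2 qp1 qp2 se so lam : R) (n : nat) : R :=
  \sum_(s : 'S_(n.*2) | Dperm s)
    (x1 ^+ eareccpeak s * x2 ^+ eareccdfall s
     * y1 ^+ ereccval s * y2 ^+ ereccdrise s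
     * u1 ^+ nrcpeak s * u2 ^+ nrcdfall s
     * v1 ^+ nrcval s * v2 ^+ nrcdrise s
     * we ^+ evennrfix s * wo ^+ oddnrfix s
     * ze ^+ evenrar s * zo ^+ oddrar s
     * pm1 ^+ lcrosscpeak s * pm2 ^+ lcrosscdfall s
     * pp1 ^+ ucrosscval s * pp2 ^+ ucrosscdrise s
     * qm1 ^+ lnestcpeak s * qm2 ^+ lnestcdfall s
     * qp1 ^+ unestcval s * qp2 ^+ unestcdrise s
     * se ^+ epsnest s * so ^+ opsnest s
     * lam ^+ cyc s).

Definition pqint (R : comNzRingType) (m : nat) (p q : R) : R :=
  \sum_(j < m) p ^+ (m - 1 - j) * q ^+ j.

Section FormalPowerSeries.
Variable R : comNzRingType.

(* The series \sum_n f n t^n is represented by its coefficient sequence f. *)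
Definition fps : Type := nat -> R.
Implicit Types (f g : fps) (c : R).

Definition fps0 : fps := fun=> 0.
Definition fps1 : fps := fun n => (n == 0%N)%:R.
Definition fpsX : fps := fun n => (n == 1%N)%:R.
Definition fps_sub f g : fps := fun n => f n - g n.
Definition fps_scale c f : fps := fun n => c * f n.
Definition fps_mul f g : fps := fun n => \sum_(i < n.+1) f i * g (n - i)%N.
Definition fps_exp f k : fps := iter k (fps_mul f) fps1.

(* Inverse of a series with constant term 1, as the geometric series
   \sum_k (1 - f)^k; only the terms k <= n contribute to the coefficient
   of t^n. *)
Definition fps_inv f : fps :=
  fun n => \sum_(k < n.+1) fps_exp (fps_sub fps1 f) k n.

Lemma fps_exp_small f k n : f 0%N = 0 -> (n < k)%N -> fps_exp f k n = 0.
Proof.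
move=> f0; elim: k n => // k IH n lt_nk; rewrite /fps_exp iterS.
apply: big1 => -[[|i] /= lti] _; first by rewrite f0 mul0r.
by rewrite -/(fps_exp f k) IH ?mulr0 //; case: n lti lt_nk => // n _; rewrite ltnS subSS;
   apply: leq_ltn_trans; rewrite leq_subr.
Qed.

Lemma fps_mulV f : f 0%N = 1 -> fps_mul f (fps_inv f) =1 fps1.
Proof.
move=> f0 n; set h := fps_sub fps1 f.
have h0 : h 0%N = 0 by rewrite /h /fps_sub f0 subrr.
have step k : fps_mul f (fps_exp h k) n = fps_exp h k n - fps_exp h k.+1 n.
  rewrite [fps_exp h k.+1]/(fps_mul h (fps_exp h k)) /fps_mul.
  apply/(canRL (addrK _)); rewrite -big_split /= (bigD1 ord0) //= big1 => [|i].
    by rewrite addr0 -mulrDl subn0 /h /fps_sub addrC subrK mul1r.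
  by rewrite -lt0n => i0; rewrite -mulrDl /h /fps_sub addrC subrK
     /fps1 eqn0Ngt i0 mul0r.
transitivity (\sum_(k < n.+1) fps_mul f (fps_exp h k) n).
  rewrite exchange_big /=; apply: eq_bigr => i _; rewrite -mulr_sumr.
  congr (_ * _); rewrite /fps_inv -/h.
  rewrite (big_ord_widen n.+1 (fun k => fps_exp h k (n - i)%N)) ?ltnS ?leq_subr //.
  rewrite big_mkcond; apply: eq_bigr => k _; case: ifPn => //.
  by rewrite -leqNgt => lt_k; rewrite fps_exp_small.
under eq_bigr => k _ do rewrite step.
rewrite -(big_mkord predT (fun k => fps_exp h k n - fps_exp h k.+1 n)).
under eq_bigr => k _ do rewrite -opprB.
by rewrite sumrN telescope_sumr // (@fps_exp_small h n.+1) // sub0r opprK.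
Qed.

(* [tfrac_trunc delta alpha N m] is the finite continued fraction
     1/(1 - delta_m t - alpha_m t/(1 - delta_(m+1) t - alpha_(m+1) t/( ...
       ... /(1 - delta_(m+N-1) t))))
   with N levels. *)
Fixpoint tfrac_trunc (delta alpha : nat -> R) (N m : nat) : fps :=
  if N is N'.+1 then
    fps_inv
      (fps_sub (fps_sub fps1 (fps_scale (delta m) fpsX))
         (fps_mul (fps_scale (alpha m) fpsX) (tfrac_trunc delta alpha N' m.+1)))
  else fps0.

(* Convergence in the t-adic topology. *)
Definition fps_cvg (F : nat -> fps) f : Prop :=
  forall n, exists N0, forall N, (N0 <= N)%N -> F N n = f n.

(* The infinite continued fraction with coefficients delta_k, alpha_k, k >= 1,
   converges to f; delta 0 and alpha 0 are not used. *)
Definition is_tfrac (delta alpha : nat -> R) f : Prop :=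
  fps_cvg (fun N => tfrac_trunc delta alpha N 1) f.

End FormalPowerSeries.

(* Main.v *)
(* Sweep over the indices, drawing the lower arcs from left to right and then the
   upper arcs from right to left.  Given the cycle type of every index, each
   lower source chooses its image among the open targets, and the rank of the
   choice gives its crossings and nestings; likewise for upper sources.  A cycle
   is closed exactly when the image of its minimum is drawn; the minimum is a
   fixed point or a valley, and at a valley exactly one of the h + 1 choices
   closes a cycle.  When crossings and nestings of valleys weigh the same, their
   choices add up to (lambda + h) p^h y, so that the sum over D-permutations
   becomes a sum over lattice paths with weights depending on heights only,
   which is the path expansion of the continued fraction. *)
Require Import Defs.
From HB Require Import structures.
From mathcomp Require Import all_boot all_order all_algebra all_fingroup.
From mathcomp Require Import ring zify.

Set Implicit Arguments.
Unset Strict Implicit.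
Unset Printing Implicit Defensive.

Import GRing.Theory.
Local Open Scope ring_scope.

(** * Power series and transfer recursions *)

(** The order of the sweep is dictated by $\lambda$. When the image of a valley $i$ is chosen, the
    images of all larger indices are known; following them backwards from $i$ leads to a unique
    index, and choosing that index is the only way to make $i$ the minimum of its cycle. As the
    lower arcs are complete by then, this index is always an open target. Its rank among the open
    targets depends on the past, however, so $\lambda$ separates from the rank weights only if all
    ranks weigh the same; this is what $v_1=y_1$ and $q_{+1}=p_{+1}$ achieve. *)

Section PowerSeries.
Variable R : comNzRingType.
Implicit Types (f g : fps R) (c : R).

Definition fps_shift f : fps R := fun n => if n is n'.+1 then f n' else 0.

Lemma eq_fps_mul f f' g g' : f =1 f' -> g =1 g' -> fps_mul f g =1 fps_mul f' g'.
Proof. by move=> ff gg n; apply: eq_bigr => i _; rewrite ff gg. Qed.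

Lemma coef_mul_trunc K f g n : (n < K)%N ->
  (\poly_(i < K) f i * \poly_(i < K) g i)`_n = fps_mul f g n.
Proof.
move=> ltnK; rewrite coefM; apply: eq_bigr => i _; rewrite !coef_poly.
by rewrite !ifT //; have := ltn_ord i; lia.
Qed.

(** Associativity is inherited from [{poly R}]: the coefficient of index [n] involves only
    coefficients of index at most [n], which the truncations at [n.+1] retain. *)
Lemma fps_mulA f g h : fps_mul f (fps_mul g h) =1 fps_mul (fps_mul f g) h.
Proof.
move=> n; pose p u : {poly R} := \poly_(i < n.+1) u i.
have pE u v i : (i < n.+1)%N -> (p u * p v)`_i = (p (fps_mul u v))`_i.
  by move=> lti; rewrite coef_poly lti /p coef_mul_trunc.
rewrite -!(@coef_mul_trunc n.+1) // -!/(p _).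
transitivity ((p f * (p g * p h))`_n).
  by rewrite !coefM; apply: eq_bigr => i _; rewrite pE //; lia.
by rewrite mulrA !coefM; apply: eq_bigr => i _; rewrite pE // ltn_ord.
Qed.

Lemma fps_mul1 f : fps_mul (fps1 R) f =1 f.
Proof.
move=> n; rewrite /fps_mul big_ord_recl big1 ?addr0 ?subn0 ?mul1r //.
by move=> i _; rewrite /fps1 /= mul0r.
Qed.

Lemma fps_mulB f g h : fps_mul (fps_sub f g) h =1 fps_sub (fps_mul f h) (fps_mul g h).
Proof.
move=> n; rewrite /fps_mul /fps_sub -sumrB.
by apply: eq_bigr => i _; rewrite mulrBl.
Qed.

Lemma fps_mul_scaleX c f n : fps_mul (fps_scale c (fpsX R)) f n = c * fps_shift f n.
Proof.
case: n => [|n]; rewrite /fps_mul big_ord_recl /fps_scale /fpsX /= mulr0n mulr0 mul0r add0r.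
  by rewrite big_ord0.
rewrite big_ord_recl big1 ?addr0 /= ?mulr1 ?subSS ?subn0 //.
by move=> i _; rewrite /= mulr0 mul0r.
Qed.

Lemma fps_mul_shiftr f g : fps_mul f (fps_shift g) =1 fps_shift (fps_mul f g).
Proof.
case=> [|n]; rewrite /fps_mul; first by rewrite big_ord1 mulr0.
rewrite big_ord_recr /= subnn mulr0 addr0; apply: eq_bigr => i _.
by rewrite subSn // -ltnS ltn_ord.
Qed.

Lemma fps_mul_scaler c f g : fps_mul f (fps_scale c g) =1 fps_scale c (fps_mul f g).
Proof.
by move=> n; rewrite /fps_mul /fps_scale mulr_sumr; apply: eq_bigr => i _; rewrite mulrCA.
Qed.

(** This is $T = 1 + \delta t T + \alpha t T' T$, multiplied by an arbitrary [g] so that it unfolds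
    the outermost tail of a product. *)
Lemma tfrac_truncS_mul (delta alpha : nat -> R) N m g n :
  fps_mul (tfrac_trunc delta alpha N.+1 m) g n =
  g n + delta m * fps_shift (fps_mul (tfrac_trunc delta alpha N.+1 m) g) n
  + alpha m * fps_shift
      (fps_mul (tfrac_trunc delta alpha N m.+1)
         (fps_mul (tfrac_trunc delta alpha N.+1 m) g)) n.
Proof.
set T := tfrac_trunc _ _ N.+1 m; set T' := tfrac_trunc _ _ N m.+1.
set D := fps_sub (fps_sub (fps1 R) (fps_scale (delta m) (fpsX R)))
         (fps_mul (fps_scale (alpha m) (fpsX R)) T').
have D0 : D 0%N = 1.
  by rewrite /D /fps_sub fps_mul_scaleX /fps_scale /fpsX /fps1 /= !mulr0 !subr0.
have DT : fps_mul D (fps_mul T g) =1 g.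
  move=> k; rewrite fps_mulA (@eq_fps_mul _ (fps1 R) g g) ?fps_mul1 //.
  exact: fps_mulV.
move: (DT n); rewrite /D fps_mulB /fps_sub fps_mulB /fps_sub fps_mul1 -fps_mulA.
rewrite !fps_mul_scaleX => /(canRL (subrK _)) /(canRL (subrK _)) ->.
by rewrite addrAC.
Qed.

(** Height [h] is level [2h] of a lattice path before an odd index and level [2h-1] before an even
    one. Then [a] and [e] weigh up steps, [o] and [b] down steps, and [t] marks a pair of steps. At
    height 0 the pair [o], [e] dips below level 0 and returns: this is the level step [delta 1]. The
    value [h.-1] at [h = 0] is harmless because [b 0 = 0]. *)
Lemma tfrac_transfer (a b e o delta alpha : nat -> R) (Q : nat -> nat -> R) :
    b 0%N = 0 -> (forall h, Q 0%N h = (h == 0%N)%:R) ->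
    (forall n h, Q n.+1 h = a h * (b h.+1 * Q n h + e h.+1 * Q n h.+1)
                          + o h * (b h * Q n h.-1 + e h * Q n h)) ->
    (forall h, alpha h.*2.+1 = a h * b h.+1) ->
    (forall h, alpha h.*2.+2 = e h.+1 * o h.+1) ->
    delta 1%N = e 0%N * o 0%N -> (forall n, (2 <= n)%N -> delta n = 0) ->
  is_tfrac delta alpha (fun n => Q n 0%N).
Proof.
move=> b0 Q0 QS alpha_odd alpha_even delta1 delta2 n.
exists (n.*2 + 5)%N => N leN.
(* [S m] is the tail at level [m] of the truncation with [N] levels, so all tails end at the same
   depth. *)
pose S m := tfrac_trunc delta alpha (N.+1 - m) m.
have SE m g k : (0 < m <= N)%N -> fps_mul (S m) g k =
    g k + delta m * fps_shift (fps_mul (S m) g) k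
    + alpha m * fps_shift (fps_mul (S m.+1) (fps_mul (S m) g)) k.
  move=> /andP[m0 mN]; rewrite /S subSn // tfrac_truncS_mul.
  by rewrite subSS.
(* [Z_even h] (resp. [Z_odd h]) is the generating function of the paths from
   level 2h (resp. 2h+1) down to level 0; it factors through the last visits
   to the intermediate levels. *)
pose Zo_of h (z : fps R) := fps_mul (S h.*2.+2) (fps_scale (b h.+1) (fps_shift z)).
pose Z_even := fix Z h := if h is h'.+1
  then fps_mul (S h.*2.+1) (fps_scale (o h) (Zo_of h' (Z h')))
  else fps_mul (S 1%N) (fps1 R).
pose Z_odd h := Zo_of h (Z_even h).
have ZoE h k : (h.*2 + 3 <= N)%N -> Z_odd h k =
    fps_shift (fun i => b h.+1 * Z_even h i + e h.+1 * Z_even h.+1 i) k.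
  move=> hN; rewrite {1}/Z_odd /Zo_of SE; last by lia.
  rewrite delta2 // mul0r addr0 alpha_even -/(Zo_of h (Z_even h)).
  case: k => [|k] /=; first by rewrite /fps_scale /= !mulr0 addr0.
  rewrite -/(Zo_of h (Z_even h)) fps_mul_scaler /fps_scale /=.
  by rewrite -mulrA.
have ZoS h k : (h.*2 + 3 <= N)%N -> Z_odd h k.+1 =
    b h.+1 * Z_even h k + e h.+1 * Z_even h.+1 k by move=> hN; rewrite ZoE.
have Zo_shift h k : fps_shift (fps_mul (S h.*2.+2) (Z_even h)) k * b h.+1 = Z_odd h k.
  rewrite /Z_odd /Zo_of fps_mul_scaler /fps_scale mulrC.
  by rewrite fps_mul_shiftr.
have ZeS h k : (h.*2 + 5 <= N)%N -> Z_even h.+1 k =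
    o h.+1 * Z_odd h k + a h.+1 * Z_odd h.+1 k.
  move=> hN; rewrite {1}/Z_even -/Z_even SE; last by lia.
  rewrite delta2 // mul0r addr0 /fps_scale -/(Z_odd h); congr (_ + _).
  by rewrite -doubleS alpha_odd -Zo_shift -mulrA [b _ * _]mulrC.
have Ze0 k : Z_even 0%N k = fps1 R k + delta 1%N * fps_shift (Z_even 0%N) k
    + a 0%N * Z_odd 0%N k.
  rewrite {1}/Z_even SE; last by lia.
  congr (_ + _); by rewrite (alpha_odd 0%N) -Zo_shift -mulrA [b _ * _]mulrC.
(* Extracting one power of [t] lowers [k] by one and raises [h] by at most one, so [2k + 2h] does
   not grow and the end of the truncation is never met. *)
have main k h : (k.*2 + h.*2 + 5 <= N)%N -> Z_even h k = Q k h.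
  elim: k h => [|k IHk] [|h] hN.
  - by rewrite Ze0 Q0 /= ZoE ?mulr0 ?addr0 //; lia.
  - by rewrite ZeS ?Q0 ?ZoE /= ?mulr0 ?addr0 //; lia.
  - rewrite Ze0 QS ZoS; last by lia.
    rewrite -[fps_shift _ _]/(Z_even 0%N k).
    rewrite !IHk; try lia.
    by rewrite b0 delta1 /fps1 mulr0n; ring.
  rewrite ZeS ?ZoS; try lia.
  by rewrite !IHk ?QS /= 1?addrC //; lia.
rewrite -main; last by lia.
rewrite /= /S subSS subn0; rewrite /fps_mul /fps1.
rewrite big_ord_recr /= subnn mulr1 big1 ?add0r // => i _.
by rewrite subn_eq0 leqNgt ltn_ord mulr0.
Qed.

End PowerSeries.

(** * Words of cycle types *)

Section Words.

(* A letter describes the cycle type of an index of known parity: [None] is a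
   fixed point, [Some true] a valley (odd) or a peak (even), and [Some false] a
   double rise (odd) or a double fall (even). *)
Definition letter : Type := option bool.

Lemma big_letter (R : nmodType) (F : letter -> R) :
  \sum_a F a = F (Some true) + F (Some false) + F None.
Proof.
rewrite (bigD1 (Some true)) // (bigD1 (Some false)) //= (bigD1 None) //=.
by rewrite big1 ?addr0 ?addrA // => -[[]|].
Qed.

(* [o] is the parity of the first index of the word ([true] for odd). *)
Definition valleys N (o : bool) (w : 'I_N -> letter) (k : nat) : nat :=
  \sum_(j < N) [&& o (+) odd j, w j == Some true & (j < k)%N].
Definition peaks N (o : bool) (w : 'I_N -> letter) (k : nat) : nat :=
  \sum_(j < N) [&& ~~ (o (+) odd j), w j == Some true & (j < k)%N].
Definition height N o h (w : 'I_N -> letter) (k : nat) : nat :=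
  (h + valleys o w k - peaks o w k)%N.
(** The first condition keeps the subtraction in [height] from truncating; the second makes the word
    end at height 0. *)
Definition balanced N o h (w : 'I_N -> letter) : bool :=
  [forall k : 'I_N.+1, peaks o w k <= h + valleys o w k]%N
  && (h + valleys o w N == peaks o w N)%N.

Definition next_height (o : bool) (a : letter) (h : nat) : nat :=
  if a == Some true then if o then h.+1 else h.-1 else h.

Variables (R : comNzRingType) (step : bool -> letter -> nat -> R).

Fixpoint path_sum (o : bool) (N h : nat) : R :=
  if N is N'.+1 then \sum_a step o a h * path_sum (~~ o) N' (next_height o a h)
  else (h == 0%N)%:R.

Lemma eq_balanced N o h (w w' : 'I_N -> letter) :
  w =1 w' -> balanced o h w = balanced o h w'.
Proof.
move=> ww'; have V k : valleys o w k = valleys o w' k.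
  by apply: eq_bigr => j _; rewrite ww'.
have P k : peaks o w k = peaks o w' k by apply: eq_bigr => j _; rewrite ww'.
by rewrite /balanced V P; congr (_ && _); apply: eq_forallb => k; rewrite V P.
Qed.

Lemma eq_height N o h (w w' : 'I_N -> letter) k :
  w =1 w' -> height o h w k = height o h w' k.
Proof.
move=> ww'; rewrite /height; congr (_ + _ - _)%N.
  by apply: eq_bigr => j _; rewrite ww'.
by apply: eq_bigr => j _; rewrite ww'.
Qed.

Lemma valleys0 N o (w : 'I_N -> letter) : valleys o w 0 = 0%N.
Proof. by apply: big1 => j _; rewrite ltn0 !andbF. Qed.

Lemma peaks0 N o (w : 'I_N -> letter) : peaks o w 0 = 0%N.
Proof. by apply: big1 => j _; rewrite ltn0 !andbF. Qed.

Lemma valleys_cons N o (w : 'I_N.+1 -> letter) k :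
  valleys o w k.+1 =
    ((o && (w ord0 == Some true)) + valleys (~~ o) (w \o lift ord0) k)%N.
Proof.
rewrite /valleys big_ord_recl /= addbF andbT; congr (_ + _)%N.
by apply: eq_bigr => j _ /=; rewrite /bump /= add1n ltnS addbN addNb.
Qed.

Lemma peaks_cons N o (w : 'I_N.+1 -> letter) k :
  peaks o w k.+1 =
    ((~~ o && (w ord0 == Some true)) + peaks (~~ o) (w \o lift ord0) k)%N.
Proof.
rewrite /peaks big_ord_recl /= addbF andbT; congr (_ + _)%N.
by apply: eq_bigr => j _ /=; rewrite /bump /= add1n ltnS addbN addNb.
Qed.

(** A peak at height 0, where [h.-1] would silently stay at 0 and [next_height] would lose track of
    [height]. *)
Definition blocked (o : bool) (a : letter) (h : nat) : bool :=
  [&& ~~ o, a == Some true & h == 0%N].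

Lemma balanced_cons N o h (w : 'I_N.+1 -> letter) :
  balanced o h w = ~~ blocked o (w ord0) h
    && balanced (~~ o) (next_height o (w ord0) h) (w \o lift ord0).
Proof.
rewrite /balanced valleys_cons peaks_cons andbA.
have [blk | nblk] := boolP (blocked o (w ord0) h) => /=.
  apply/negbTE/nandP; left; apply/forallP => /(_ (lift ord0 ord0)) /=.
  rewrite /bump leq0n valleys_cons peaks_cons valleys0 peaks0.
  by case/and3P: blk => /negbTE-> -> /eqP->.
have eq_next x y : ((~~ o && (w ord0 == Some true)) + x <=
    h + ((o && (w ord0 == Some true)) + y))%N
  = (x <= next_height o (w ord0) h + y)%N.
  by move: nblk; rewrite /blocked /next_height; case: (o); case: (w ord0 == _) => //=; lia.
have eq_next' x y : (h + ((o && (w ord0 == Some true)) + y) ==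
    (~~ o && (w ord0 == Some true)) + x)%N
  = (next_height o (w ord0) h + y == x)%N.
  by move: nblk; rewrite /blocked /next_height; case: (o); case: (w ord0 == _) => //=; lia.
rewrite eq_next'; congr (_ && _); apply/forallP/forallP => H k.
  by have := H (lift ord0 k); rewrite /= /bump leq0n valleys_cons peaks_cons eq_next.
case: (unliftP ord0 k) => [j|] ->; last by rewrite peaks0.
by rewrite /= /bump leq0n valleys_cons peaks_cons eq_next.
Qed.

Lemma height_cons N o h (w : 'I_N.+1 -> letter) k : ~~ blocked o (w ord0) h ->
  height o h w k.+1 =
    height (~~ o) (next_height o (w ord0) h) (w \o lift ord0) k.
Proof.
rewrite /height valleys_cons peaks_cons /blocked /next_height.
by case: (o); case: (w ord0 == _) => //=; lia.
Qed.

Lemma height0 N o h (w : 'I_N -> letter) : height o h w 0 = h.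
Proof. by rewrite /height valleys0 peaks0 addn0 subn0. Qed.

(** [balanced] forbids peaks at height 0 while [path_sum] admits them; the hypothesis reconciles the
    two by giving them weight 0. *)
Lemma sum_balanced N o h : step false (Some true) 0 = 0 ->
  \sum_(t : N.-tuple letter | balanced o h (tnth t))
    \prod_(i < N) step (o (+) odd i) (tnth t i) (height o h (tnth t) i)
  = path_sum o N h.
Proof.
move=> step0; elim: N o h => [|N IHN] o h /=.
  rewrite big_mkcond (big_pred1 [tuple]) => [|t]; last by symmetry; apply/eqP; exact: tuple0.
  rewrite big_ord0 /balanced /valleys /peaks !big_ord0 addn0.
  case: forallP => [_ | []] /=; first by case: eqP.
  by move=> k; rewrite big_ord0.
pose F (p : letter * N.-tuple letter) : N.+1.-tuple letter := [tuple of p.1 :: p.2].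
pose F' (t : N.+1.-tuple letter) : letter * N.-tuple letter :=
  (thead t, [tuple of behead t]).
have FK t : F (F' t) = t by rewrite [RHS]tuple_eta; apply: val_inj.
rewrite (reindex F) /=; last first.
  by exists F' => [[a t] _ | t _]; rewrite ?FK // /F' /F theadE; congr (_, _); apply: val_inj.
rewrite big_mkcond -(pair_big xpredT xpredT (fun a t => if balanced o h (tnth (F (a, t)))
   then \prod_(i < N.+1) step (o (+) odd i) (tnth (F (a, t)) i)
          (height o h (tnth (F (a, t))) i) else 0)) /=.
apply: eq_bigr => a _.
have F0 t : tnth (F (a, t)) ord0 = a by [].
have FS t : tnth (F (a, t)) \o lift ord0 =1 tnth t.
  by move=> i; rewrite /= tnthS.
have [blk | nblk] := boolP (blocked o a h).
  rewrite big1 => [|t _]; last by rewrite balanced_cons F0 blk.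
  by case/and3P: blk => /negbTE-> /eqP-> /eqP->; rewrite step0 mul0r.
rewrite -IHN mulr_sumr [RHS]big_mkcond; apply: eq_bigr => t _.
rewrite balanced_cons F0 nblk /= (eq_balanced _ _ (FS t)); case: ifP => // _.
rewrite big_ord_recl addbF F0 height0; congr (_ * _).
apply: eq_bigr => i _; rewrite /= /bump leq0n height_cons ?F0 //.
by rewrite (eq_height _ _ _ (FS t)) tnthS addNb addbN.
Qed.

End Words.

(** * Sequential choices *)

Section SequentialSum.
Variable I : finType.
Implicit Types (f g : {ffun I -> I}) (i j b : I).

Definition upd f i b : {ffun I -> I} := [ffun j => if j == i then b else f j].

Lemma upd_same f i b : upd f i b i = b.
Proof. by rewrite ffunE eqxx. Qed.

Lemma upd_other f i b j : j != i -> upd f i b j = f j.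
Proof. by move=> /negbTE ne; rewrite ffunE ne. Qed.

(* The values of [f] are chosen one at a time, in the order given by [key];
   [c i] is the total weight of the choices at [i], whatever the past. *)
Lemma sequential_sum (R : comNzRingType) (key : I -> nat)
    (W : I -> {ffun I -> I} -> R) (c : I -> R) : injective key ->
    (forall i j b f, (key j < key i)%N -> W j (upd f i b) = W j f) ->
    (forall i f, let past := \prod_(j | (key j < key i)%N) W j f in
       past * \sum_b W i (upd f i b) = past * c i) ->
  \sum_f \prod_i W i f = \prod_i c i.
Proof.
move=> key_inj W_loc W_sum.
(* Functions pinned to the identity at keys from [k] on represent the partial choices made before
   stage [k]. *)
pose A k f := [forall i, (k <= key i)%N ==> (f i == i)].
have S k : \sum_(f | A k f) \prod_(i | (key i < k)%N) W i f =
           \prod_(i | (key i < k)%N) c i.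
  elim: k => [|k IHk].
    rewrite (big_pred1 [ffun i => i]) => [|f]; first by rewrite !big_pred0.
    apply/forallP/eqP => [H | -> i]; last by rewrite ffunE eqxx implybT.
    by apply/ffunP => i; rewrite ffunE; apply/eqP/H.
  have [/existsP[i /eqP key_i] | /existsPn no_i] := boolP [exists i, key i == k]; last first.
    have lt_key i : (key i < k.+1)%N = (key i < k)%N.
      by rewrite ltnS leq_eqVlt (negbTE (no_i i)).
    rewrite !(eq_bigl _ _ lt_key) -IHk; apply: eq_big => [f | f _].
      by apply: eq_forallb => i; rewrite ltnNge -ltnS lt_key -leqNgt.
    exact: eq_bigl.
  have lt_key j : (key j < k.+1)%N && (j != i) = (key j < k)%N.
    rewrite ltnS leq_eqVlt -key_i (inj_eq key_inj).
    by case: (eqVneq j i) => [-> | ]; rewrite ?ltnn ?andbT.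
  have prodS F : \prod_(j | (key j < k.+1)%N) F j =
                 F i * \prod_(j | (key j < k)%N) F j :> R.
    by rewrite (bigD1 i) ?key_i //= (eq_bigl _ _ lt_key).
  have updA b f : A k f -> A k.+1 (upd f i b).
    move=> /forallP Af; apply/forallP => j; apply/implyP => ltk.
    rewrite upd_other; first by apply: (implyP (Af j)); apply: ltnW.
    by apply: contraTneq ltk => ->; rewrite key_i ltnn.
  rewrite prodS -IHk mulr_sumr.
  (* Undoing the choice at [i] groups the functions of stage [k.+1] by their earlier choices. *)
  rewrite (partition_big (fun f => upd f i i) (A k)) => [|f /forallP Af] /=; last first.
    apply/forallP => j; apply/implyP; rewrite leq_eqVlt -key_i (inj_eq key_inj).
    have [<- _ | ne /=] := eqVneq i j; first by rewrite upd_same.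
    by rewrite key_i upd_other; [exact: (implyP (Af j)) | rewrite eq_sym].
  apply: eq_bigr => g Ag.
  have gi : g i = i by apply/eqP/(implyP (forallP Ag i)); rewrite key_i.
  rewrite (reindex_onto (fun b => upd g i b) (fun f => f i)) /=; last first.
    move=> f /andP[_ /eqP<-]; apply/ffunP => j; rewrite !ffunE.
    by case: eqP => [->|].
  rewrite (eq_bigl xpredT) => [|b]; last first.
    rewrite updA // upd_same eqxx andbT /=; apply/eqP/ffunP => j.
    by rewrite !ffunE; case: eqP => [->|].
  under eq_bigr => b _.
    rewrite prodS mulrC (eq_bigr (W^~ g)) => [|j ltj]; last first.
      by rewrite W_loc // key_i.
    over.
  by rewrite -mulr_sumr /=; move: (W_sum i g); rewrite key_i /= => ->; rewrite mulrC.
pose k := (\max_i key i).+1.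
have lt_k i : (key i < k)%N by rewrite ltnS; apply: leq_bigmax.
have Ak f : A k f by apply/forallP => i; rewrite leqNgt lt_k.
have := S k; rewrite (eq_bigl xpredT _ Ak) (eq_bigl xpredT _ lt_k) => <-.
by apply: eq_bigr => f _; apply: eq_bigl => i; rewrite lt_k.
Qed.

End SequentialSum.

(** * Targets left open by earlier choices *)

Section OpenTargets.
Variables (I : finType) (lt : rel I).
Hypothesis lt_irr : irreflexive lt.
Hypothesis lt_trans : transitive lt.
Hypothesis lt_total : forall x y, x != y -> lt x y || lt y x.

(** On a finite chain, counting the smaller elements is a bijection onto the ranks below [#|S|], and
    counting the larger ones gives the complementary rank. For open targets these become nestings
    and crossings. *)
Lemma rank_sum (R : nmodType) (S : {set I}) (F : nat -> nat -> R) :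
  \sum_(b in S) F #|[set x in S | lt b x]| #|[set x in S | lt x b]| =
  \sum_(r < #|S|) F (#|S|.-1 - r)%N r.
Proof.
pose rk b := #|[set x in S | lt x b]|.
have rk_lt b : b \in S -> (rk b < #|S|)%N.
  move=> bS; apply: proper_card; apply/properP; split.
    by apply/subsetP => x /setIdP[].
  by exists b => //; rewrite !inE lt_irr andbF.
have rk_mono b b' : b \in S -> lt b b' -> (rk b < rk b')%N.
  move=> bS ltb; apply: proper_card; apply/properP; split.
    by apply/subsetP => x; rewrite !inE => /andP[-> /lt_trans]; apply.
  by exists b; rewrite !inE ?lt_irr ?andbF // bS.
have rk_inj : {in S &, injective rk}.
  move=> b b' bS b'S eq_rk; apply: contra_eq eq_rk => /lt_total/orP[]lt_b.
    by rewrite neq_ltn rk_mono.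
  by rewrite neq_ltn orbC rk_mono.
have co_rk b : b \in S -> #|[set x in S | lt b x]| = (#|S|.-1 - rk b)%N.
  move=> bS; rewrite [#|S|](cardsD1 b) bS /=.
  rewrite -(cardsID [set x | lt x b] (S :\ b)) /rk.
  rewrite (_ : (S :\ b) :&: _ = [set x in S | lt x b]); last first.
    apply/setP => x; rewrite !inE; case: (eqVneq x b) => [->|] //.
    by rewrite lt_irr !andbF.
  rewrite add0n addKn; congr #|pred_of_set _|; apply/setP => x; rewrite !inE.
  case: (eqVneq x b) => [->|ne]; first by rewrite lt_irr !andbF.
  case xS: (x \in S); rewrite ?andbF //= andbT.
  have /orP[ltx|ltx] := lt_total ne; rewrite ltx /=.
    by apply/negP => /(lt_trans ltx); rewrite lt_irr.
  by apply/esym/negP => /(lt_trans ltx); rewrite lt_irr.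
transitivity (\sum_(b in S) F (#|S|.-1 - rk b)%N (rk b)).
  by apply: eq_bigr => b bS; rewrite co_rk.
have [S0 | /set0Pn[b0 b0S]] := eqVneq S set0.
  by rewrite S0 cards0 big_ord0 big_set0.
have n_gt0 : (0 < #|S|)%N by rewrite (cardsD1 b0) b0S.
pose rk' b : 'I_#|S| := insubd (Ordinal n_gt0) (rk b).
have rk'E b : b \in S -> rk' b = rk b :> nat.
  by move=> bS; rewrite val_insubd rk_lt.
have rk'_inj : {in S &, injective rk'}.
  move=> b b' bS b'S /(congr1 val); rewrite /= !rk'E //; exact: rk_inj.
have full : rk' @: S = [set: 'I_#|S|].
  by apply/eqP; rewrite eqEcard subsetT card_in_imset // cardsT card_ord /=.
transitivity (\sum_(r in rk' @: S) F (#|S|.-1 - r)%N r).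
  by rewrite big_imset //=; apply: eq_bigr => b bS; rewrite rk'E.
by rewrite full; apply: eq_bigl => r; rewrite inE.
Qed.

Variables (src tgt : pred I).
Implicit Types f g : {ffun I -> I}.

(** Abstract in [lt], so that lower arcs (swept with [<]) and upper arcs (swept with [>]) share one
    theory. *)
Definition open_targets f i : {set I} :=
  [set b | [&& tgt b, lt b i & [forall j, src j && lt j i ==> (f j != b)]]].

Lemma open_targetsP f i b :
  reflect [/\ tgt b, lt b i & forall j, src j -> lt j i -> f j != b]
          (b \in open_targets f i).
Proof.
rewrite inE; apply: (iffP and3P) => -[tb ltb H]; split=> //.
  by move=> j sj ltj; apply: (implyP (forallP H j)); rewrite sj.
by apply/forallP => j; apply/implyP => /andP[]; apply: H.
Qed.

Lemma open_targets_inj f (J : pred I) :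
  (forall j, J j -> src j /\ f j \in open_targets f j) -> {in J &, injective f}.
Proof.
move=> H x y Jx Jy eqf; have [sx /open_targetsP[_ _ ox]] := H x Jx.
have [sy /open_targetsP[_ _ oy]] := H y Jy.
apply: contra_eq eqf => /lt_total/orP[]ltxy; first exact: oy.
by rewrite eq_sym; apply: ox.
Qed.

(** A target precedes its source, so the sources before [i] inject into the targets before [i]; the
    targets not hit are the open ones. *)
Lemma card_open_targets f i :
  (forall j, src j -> lt j i -> f j \in open_targets f j) ->
  (#|open_targets f i| + #|[set j | src j && lt j i]|
     = #|[set b | tgt b && lt b i]|)%N.
Proof.
move=> H; set X := [set j | _]; set Y := [set b | _].
have f_inj : {in X &, injective f}.
  apply: (@open_targets_inj f [in X]) => j /= /setIdP[sj ltj].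
  by split=> //; apply: H.
have sub : f @: X \subset Y.
  apply/subsetP => _ /imsetP[j /setIdP[sj ltj] ->]; rewrite inE.
  have /open_targetsP[-> ltf _] := H j sj ltj.
  exact: lt_trans ltj.
rewrite -(card_in_imset f_inj) -(cardsID (f @: X) Y) (setIidPr sub) addnC.
congr (_ + _)%N; congr #|pred_of_set _|; apply/setP => b; rewrite !inE.
have [tb /= | //] := boolP (tgt b); last by rewrite andbF.
have [ltb /= | //] := boolP (lt b i); last by rewrite andbF.
rewrite andbT; apply/forallP/negP => [H1 /imsetP[j /setIdP[sj ltj] eqb] | H1 j].
  by move: (H1 j); rewrite sj ltj eqb eqxx.
apply/implyP => /andP[sj ltj]; apply/eqP => eqb; apply: H1.
by apply/imsetP; exists j; rewrite ?inE ?sj.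
Qed.

Lemma eq_open_targets f g i : (forall j, src j -> lt j i -> f j = g j) ->
  open_targets f i = open_targets g i.
Proof.
move=> fg; apply/setP => b; rewrite !inE; do 2!congr (_ && _).
apply: eq_forallb => j; case: (boolP (src j && lt j i)) => // /andP[sj ltj].
by rewrite fg.
Qed.

End OpenTargets.

(** * Maximal paths and cycle minima *)

Section ChainStart.
Variable I : finType.
Implicit Types (f : I -> I) (V : {set I}).

Fixpoint chain_start_rec k f V x : I :=
  if k is k'.+1 then
    if [pick u in V | f u == x] is Some u then chain_start_rec k' f (V :\ u) u
    else x
  else x.

(* The first vertex of the maximal path ending at [x] in the graph of the
   restriction of [f] to [V]. *)
Definition chain_start f V x := chain_start_rec #|V| f V x.

Lemma eq_chain_start f (g : I -> I) V x :
  {in V, f =1 g} -> chain_start f V x = chain_start g V x.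
Proof.
rewrite /chain_start; move: #|V| => k; elim: k V x => //= k IHk V x fg.
have -> : [pick u in V | f u == x] = [pick u in V | g u == x].
  by apply: eq_pick => u /=; case uV: (u \in V) => //=; rewrite fg.
case: pickP => [u _ | //]; apply: IHk => v.
by rewrite inE => /andP[_]; apply: fg.
Qed.

(** Since [x] lies outside [V] and [f] is injective on [V], the backward walk cannot run into a
    loop, so it stops at a vertex without preimage in [V]. *)
Lemma chain_startP f V x : {in V &, injective f} -> x \notin V ->
  let s := chain_start f V x in
  [/\ s \notin f @: V, s \in x |: V &
      exists2 n, iter n f s = x & forall m, (m < n)%N -> iter m f s \in V].
Proof.
rewrite /chain_start; move Ek: #|V| => k.
elim: k V x Ek => [|k IHk] V x Ek f_inj xV /=.
  rewrite (cards0_eq Ek) imset0 !inE eqxx; split=> //; by exists 0%N.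
case: pickP => [u /andP[uV /eqP fu] | no_u]; last first.
  split; [ | by rewrite !inE eqxx | by exists 0%N].
  by apply/imsetP => -[u uV ux]; move: (no_u u); rewrite uV ux eqxx.
have Ek' : #|V :\ u| = k by move: Ek; rewrite (cardsD1 u) uV => -[].
have [||s_im s_in [n sn sV]] := IHk (V :\ u) u Ek'.
- by move=> y z /setD1P[_ yV] /setD1P[_ zV]; apply: f_inj.
- by rewrite !inE eqxx.
set s := chain_start_rec _ _ _ _ in s_im s_in sn sV *.
rewrite setD1K // in s_in; split.
- apply/imsetP => -[v vV sv]; move: s_im; have [vu | ne] := eqVneq v u.
    by move: xV; rewrite -fu -vu -sv s_in.
  by case/imsetP; exists v => //; rewrite !inE ne.
- by rewrite inE s_in orbT.
exists n.+1; first by rewrite /= sn.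
move=> m; rewrite ltnS leq_eqVlt => /predU1P[-> | /sV]; first by rewrite sn.
by case/setD1P.
Qed.

End ChainStart.

Section CycleMinima.
Variables (N : nat) (s : 'S_N).

Definition cycle_min (i : 'I_N) : bool := [forall j in porbit s i, (i <= j)%N].

Lemma card_cycle_min : #|[set i | cycle_min i]| = cyc s.
Proof.
rewrite /cyc -(card_in_imset (f := porbit s) (D := [set i | cycle_min i])).
  congr #|pred_of_set _|; apply/setP => O; apply/imsetP/imsetP => -[i].
    by move=> _ ->; exists i.
  move=> _ ->; pose P := [pred j | j \in porbit s i].
  have Pi : P i by apply: porbit_id.
  case: (arg_minnP (fun j : 'I_N => j : nat) Pi) => j Pj min_j.
  have eq_orb : porbit s i = porbit s j by apply/eqP; rewrite eq_porbit_mem porbit_sym.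
  exists j => //; rewrite inE; apply/forallP => k; apply/implyP => kj.
  by apply: min_j; rewrite inE eq_orb.
move=> i j; rewrite !inE => /forallP min_i /forallP min_j eq_orb.
apply: val_inj; apply/eqP; rewrite eqn_leq.
by rewrite (implyP (min_i j)) ?(implyP (min_j i)) // ?eq_orb ?porbit_id // -eq_orb porbit_id.
Qed.

(** The other elements of a cycle with minimum [i] form a path above [i] that leads back to [i]. The
    right-hand side sees only the values of [s] at indices from [i] on, so it is decided as soon as
    the image of [i] is chosen. *)
Lemma cycle_min_chain_start i :
  cycle_min i = (s i == chain_start s [set j : 'I_N | (i < j)%N] i).
Proof.
set V := [set j | _]; set t := chain_start s V i.
have s_inj : {in V &, injective s} by move=> x y _ _; apply: perm_inj.
have [|t_im t_in [n tn tV]] := chain_startP (x := i) s_inj; first by rewrite inE ltnn.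
rewrite -/t in t_im t_in tn tV; have iterE m x : iter m s x = (s ^+ m)%g x.
  by rewrite permX.
apply/forallP/eqP => [min_i | si j].
  (* The preimage of [t] is not above [i], where [t] has no preimage, and not below [i], as it lies
     in the cycle of [i]. *)
  have : (s^-1)%g t = i.
    apply: val_inj; apply/eqP; rewrite eqn_leq; apply/andP; split.
      rewrite leqNgt; apply: contra t_im => lt_i; apply/imsetP.
      by exists ((s^-1)%g t); rewrite ?inE ?permKV.
    apply: (implyP (min_i _)); rewrite porbit_sym -tn iterE.
    apply/porbitP; exists n.+1; rewrite expgS permM permKV //.
  by move=> <-; rewrite permKV.
apply/implyP => /porbitP[m ->].
(* The orbit returns to [i] after [n.+1] steps, so exponents may be reduced modulo [n.+1]. *)
have si_n : (s ^+ n.+1)%g i = i by rewrite expgS permM si -iterE.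
have period q : (s ^+ (q * n.+1))%g i = i.
  by elim: q => [|q IHq]; rewrite ?mul0n ?expg0 ?perm1 // mulSn expgD permM si_n.
rewrite (divn_eq m n.+1) expgD permM period.
case Em: (m %% n.+1)%N => [|r]; first by rewrite expg0 perm1.
have ltr : (r < n)%N by rewrite -ltnS -Em ltn_mod.
by rewrite expgS permM si -iterE; have := tV r ltr; rewrite inE; apply: ltnW.
Qed.

End CycleMinima.

(** * Open targets of a word *)

Section WordStructure.
Variables (N : nat) (w : 'I_N -> letter).
Implicit Types (i j b : 'I_N) (f : {ffun 'I_N -> 'I_N}).

Definition upper_src i := odd_index i && (w i != None).
Definition lower_src i := ~~ odd_index i && (w i != None).
(** The preimage is smaller at double rises (odd, [Some false]) and peaks (even, [Some true]), hence
    the negated parity. *)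
Definition upper_tgt i := w i == Some (~~ odd_index i).
Definition lower_tgt i := w i == Some (odd_index i).

Definition ord_lt i j : bool := (i < j)%N.
Definition ord_gt i j : bool := (j < i)%N.

Definition lower_open f i := open_targets ord_lt lower_src lower_tgt f i.
Definition upper_open f i := open_targets ord_gt upper_src upper_tgt f i.

Definition valid_at f i : bool :=
  if w i == None then f i == i
  else f i \in (if odd_index i then upper_open f i else lower_open f i).

(* Images are chosen for fixed points and lower sources from left to right,
   and then for upper sources from right to left. *)
Definition choice_key i : nat := if upper_src i then (N + (N - i))%N else i.

Definition above i : {set 'I_N} := [set j : 'I_N | (i < j)%N].

Lemma ord_lt_irr : irreflexive ord_lt. Proof. by move=> i; apply: ltnn. Qed.
Lemma ord_gt_irr : irreflexive ord_gt. Proof. by move=> i; apply: ltnn. Qed.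
Lemma ord_lt_trans : transitive ord_lt. Proof. by move=> j i k; apply: ltn_trans. Qed.
Lemma ord_gt_trans : transitive ord_gt.
Proof. by move=> j i k ltji ltkj; apply: ltn_trans ltji. Qed.
Lemma ord_lt_total i j : i != j -> ord_lt i j || ord_lt j i.
Proof. by rewrite /ord_lt -neq_ltn. Qed.
Lemma ord_gt_total i j : i != j -> ord_gt i j || ord_gt j i.
Proof. by rewrite /ord_gt -neq_ltn eq_sym. Qed.

Lemma odd_indexE i : odd_index i = true (+) odd i. Proof. by []. Qed.

Lemma choice_key_inj : injective choice_key.
Proof.
move=> i j; rewrite /choice_key; have := ltn_ord i; have := ltn_ord j.
by case: ifP => _; case: ifP => _ *; apply: val_inj => /=; lia.
Qed.

Lemma key_lower i j : ~~ upper_src i -> ~~ upper_src j ->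
  (choice_key i < choice_key j)%N = (i < j)%N.
Proof. by rewrite /choice_key => /negbTE-> /negbTE->. Qed.

Lemma key_upper i j : upper_src i -> upper_src j ->
  (choice_key i < choice_key j)%N = (j < i)%N.
Proof.
rewrite /choice_key => -> ->; have := ltn_ord i; have := ltn_ord j.
by lia.
Qed.

Lemma key_lower_upper i j : ~~ upper_src i -> upper_src j ->
  (choice_key i < choice_key j)%N.
Proof. rewrite /choice_key => /negbTE-> ->; have := ltn_ord i; lia. Qed.

Lemma lower_srcN i : lower_src i -> ~~ upper_src i.
Proof. by rewrite /lower_src /upper_src => /andP[/negbTE->]. Qed.

Lemma upper_lower_tgt i : upper_tgt i -> ~~ lower_tgt i.
Proof. by rewrite /upper_tgt /lower_tgt => /eqP->; apply/eqP => -[]; case: odd_index. Qed.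

Variant valid_spec f i : Prop :=
  | ValidFix of w i = None & f i = i
  | ValidUpper of upper_src i & odd_index i & f i \in upper_open f i
  | ValidLower of lower_src i & ~~ odd_index i & f i \in lower_open f i.

Lemma validP f i : valid_at f i -> valid_spec f i.
Proof.
rewrite /valid_at; have [wi /eqP | wi] := eqVneq (w i) None; first exact: ValidFix.
case: ifPn => oi fi; first by apply: ValidUpper; rewrite // /upper_src oi wi.
by apply: ValidLower; rewrite // /lower_src oi wi.
Qed.

Lemma valid_upper f i : upper_src i -> valid_at f i -> f i \in upper_open f i.
Proof. by rewrite /valid_at => /andP[-> /negbTE->]. Qed.

Lemma valid_lower f i : lower_src i -> valid_at f i -> f i \in lower_open f i.
Proof. by rewrite /valid_at => /andP[/negbTE-> /negbTE->]. Qed.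

(** Fixed points, upper targets and lower targets are disjoint, and within each class an image
    already taken is not open. The predicate [J] admits partially made choices. *)
Lemma valid_inj f (J : pred 'I_N) : (forall j, J j -> valid_at f j) ->
  {in J &, injective f}.
Proof.
move=> valid_f.
have upper_inj : {in [pred j | J j && upper_src j] &, injective f}.
  apply: (open_targets_inj ord_gt_total (src := upper_src) (tgt := upper_tgt)) => j /andP[Jj uj].
  by split=> //; apply: (valid_upper uj); apply: valid_f.
have lower_inj : {in [pred j | J j && lower_src j] &, injective f}.
  apply: (open_targets_inj ord_lt_total (src := lower_src) (tgt := lower_tgt)) => j /andP[Jj uj].
  by split=> //; apply: (valid_lower uj); apply: valid_f.
have tgtU j : f j \in upper_open f j -> upper_tgt (f j).
  by case/open_targetsP.
have tgtL j : f j \in lower_open f j -> lower_tgt (f j).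
  by case/open_targetsP.
have tgtF j : w j = None -> ~~ upper_tgt j && ~~ lower_tgt j.
  by rewrite /upper_tgt /lower_tgt => ->.
move=> i j Ji Jj eqf.
case: (validP (valid_f i Ji)) => [wi fi | ui oi fi | li oi fi];
  case: (validP (valid_f j Jj)) => [wj fj | uj oj fj | lj oj fj].
- by rewrite -fi -fj.
- by move: (tgtU _ fj); rewrite -eqf fi => u; case/andP: (tgtF i wi); rewrite u.
- by move: (tgtL _ fj); rewrite -eqf fi => u; case/andP: (tgtF i wi); rewrite u.
- by move: (tgtU _ fi); rewrite eqf fj => u; case/andP: (tgtF j wj); rewrite u.
- by apply: upper_inj => //; apply/andP.
- by move: (tgtU _ fi) (tgtL _ fj); rewrite eqf => /upper_lower_tgt/negbTE->.
- by move: (tgtL _ fi); rewrite eqf fj => u; case/andP: (tgtF j wj); rewrite u.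
- by move: (tgtU _ fj) (tgtL _ fi); rewrite eqf => /upper_lower_tgt/negbTE->.
by apply: lower_inj => //; apply/andP.
Qed.

Lemma card_sumb (P : pred 'I_N) : #|[set j | P j]| = (\sum_j P j)%N.
Proof. by rewrite -sum1dep_card big_mkcond; apply: eq_bigr => j _; case: (P j). Qed.

(** Lower targets are valleys and double falls, lower sources are peaks and double falls; the double
    falls cancel and the height before [i] remains. *)
Lemma lower_open_card f i : (forall j, lower_src j -> (j < i)%N -> valid_at f j) ->
  (#|lower_open f i| + peaks true w i = valleys true w i)%N.
Proof.
move=> valid_f; pose falls := (\sum_(j < N) [&& ~~ odd_index j, w j == Some false & (j < i)%N])%N.
have : (#|lower_open f i| + #|[set j | lower_src j && ord_lt j i]| =
        #|[set b | lower_tgt b && ord_lt b i]|)%N.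
  apply: card_open_targets => [||j lj ltj]; [exact: ord_lt_trans | exact: ord_lt_total |].
  by apply: (valid_lower lj); apply: valid_f.
rewrite !card_sumb => H.
apply/eqP; rewrite -(eqn_add2r falls); apply/eqP; rewrite -addnA.
have -> : (peaks true w i + falls = \sum_(j < N) (lower_src j && ord_lt j i))%N.
  rewrite -big_split; apply: eq_bigr => j _; rewrite /lower_src /ord_lt ?odd_indexE /=.
  by case: (odd j); case: (w j) => [[]|] //=; rewrite ?addn0.
rewrite H -big_split; apply: eq_bigr => j _; rewrite /lower_tgt /ord_lt ?odd_indexE /=.
by case: (odd j); case: (w j) => [[]|] //=; rewrite ?addn0.
Qed.

Definition balanced_word := balanced true 0 w.

Lemma peaks_le i : balanced_word -> (peaks true w i <= valleys true w i)%N.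
Proof.
by case/andP=> /forallP/(_ (widen_ord (leqnSn N) i)).
Qed.

Lemma peaks_total : balanced_word -> valleys true w N = peaks true w N.
Proof. by case/andP=> _ /eqP. Qed.

(** The analogous counts to the right of [i] become counts up to [i] by the final balance. The bound
    [i.+1] includes [i] itself, so a valley has one more open target than the height before it. *)
Lemma upper_open_card f i : balanced_word ->
    (forall j, upper_src j -> (i < j)%N -> valid_at f j) ->
  (#|upper_open f i| + peaks true w i.+1 = valleys true w i.+1)%N.
Proof.
move=> bal valid_f.
pose rises := (\sum_(j < N) [&& odd_index j, w j == Some false & (i < j)%N])%N.
have : (#|upper_open f i| + #|[set j | upper_src j && ord_gt j i]| =
        #|[set b | upper_tgt b && ord_gt b i]|)%N.
  apply: card_open_targets => [||j lj ltj]; [exact: ord_gt_trans | exact: ord_gt_total |].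
  by apply: (valid_upper lj); apply: valid_f.
rewrite !card_sumb => H.
pose vals' := (\sum_(j < N) [&& odd_index j, w j == Some true & (i < j)%N])%N.
pose peaks' := (\sum_(j < N) [&& ~~ odd_index j, w j == Some true & (i < j)%N])%N.
have Hv : (valleys true w i.+1 + vals' = valleys true w N)%N.
  rewrite -big_split; apply: eq_bigr => j _; rewrite ?odd_indexE ltn_ord ltnS /=.
  by case: (odd j); case: (w j == _) => //=; case: leqP.
have Hp : (peaks true w i.+1 + peaks' = peaks true w N)%N.
  rewrite -big_split; apply: eq_bigr => j _; rewrite ?odd_indexE ltn_ord ltnS /=.
  by case: (odd j); case: (w j == _) => //=; case: leqP.
have Hs : (vals' + rises = \sum_(j < N) (upper_src j && ord_gt j i))%N.
  rewrite -big_split; apply: eq_bigr => j _; rewrite /upper_src /ord_gt ?odd_indexE /=.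
  by case: (odd j); case: (w j) => [[]|] //=; rewrite ?addn0.
have Ht : (peaks' + rises = \sum_(j < N) (upper_tgt j && ord_gt j i))%N.
  rewrite -big_split; apply: eq_bigr => j _; rewrite /upper_tgt /ord_gt ?odd_indexE /=.
  by case: (odd j); case: (w j) => [[]|] //=; rewrite ?addn0.
move: (peaks_total bal) H; rewrite -Hs -Ht -Hv -Hp.
by move: vals' peaks' rises {Hv Hp Hs Ht} => v p r; lia.
Qed.

Lemma card_lower_src_tgt : balanced_word ->
  #|[set j | lower_src j]| = #|[set j | lower_tgt j]|.
Proof.
move=> /peaks_total; rewrite !card_sumb => E.
pose falls := (\sum_(j < N) [&& ~~ odd_index j & w j == Some false])%N.
transitivity (peaks true w N + falls)%N.
  rewrite -big_split; apply: eq_bigr => j _; rewrite /lower_src ?odd_indexE ltn_ord /=.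
  by case: (odd j); case: (w j) => [[]|].
rewrite -E -big_split; apply: eq_bigr => j _; rewrite /lower_tgt ?odd_indexE ltn_ord /=.
by case: (odd j); case: (w j) => [[]|].
Qed.

Lemma lower_tgt_image f b : balanced_word ->
    (forall j, lower_src j -> valid_at f j) -> lower_tgt b ->
  exists2 j, lower_src j & f j = b.
Proof.
move=> bal valid_f tb.
have f_inj : {in [set j | lower_src j] &, injective f}.
  move=> x y; rewrite inE => lx; rewrite inE => ly.
  exact: (valid_inj (J := lower_src) valid_f).
have : b \in f @: [set j | lower_src j].
  suff -> : f @: [set j | lower_src j] = [set j | lower_tgt j] by rewrite inE.
  apply/eqP; rewrite eqEcard card_in_imset // card_lower_src_tgt // leqnn andbT.
  apply/subsetP => _ /imsetP[j lj ->]; move: lj; rewrite inE => lj; rewrite inE.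
  by have /open_targetsP[] := valid_lower lj (valid_f j lj).
by case/imsetP => j; rewrite inE => lj ->; exists j.
Qed.

(* The only choice of the image of the valley [i] that closes a cycle. *)
Lemma chain_start_open f i : balanced_word -> upper_src i -> w i = Some true ->
    (forall j, (choice_key j < choice_key i)%N -> valid_at f j) ->
  chain_start f (above i) i \in upper_open f i.
Proof.
move=> bal ui wi valid_f; set s := chain_start _ _ _.
have valid_low j : lower_src j -> valid_at f j.
  by move=> /lower_srcN nuj; apply: valid_f; apply: key_lower_upper.
have valid_above j : (i < j)%N -> valid_at f j.
  move=> ltij; apply: valid_f; have [uj | nuj] := boolP (upper_src j).
    by rewrite key_upper.
  exact: key_lower_upper.
have f_inj : {in above i &, injective f}.
  move=> x y; rewrite !inE => ix iy.
  exact: (valid_inj (J := fun j : 'I_N => (i < j)%N) valid_above).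
(* Lower targets from [i] on have their sources above [i]. The chain start has no preimage above
   [i], so it is neither the valley [i], nor a fixed point, nor a lower target; an upper target is
   all that is left. *)
have low_im b : lower_tgt b -> (i <= b)%N -> b \in f @: above i.
  move=> tb leib; have [j lj fj] := lower_tgt_image bal valid_low tb.
  apply/imsetP; exists j => //; rewrite inE.
  have /open_targetsP[_] := valid_lower lj (valid_low j lj).
  by rewrite /ord_lt fj => /(leq_ltn_trans leib).
have [|s_im s_in _] := chain_startP f_inj (x := i); first by rewrite inE ltnn.
rewrite -/s in s_im s_in; have lt_is : (i < s)%N.
  move: s_in; rewrite !inE => /predU1P[si | //]; case/negP: s_im; rewrite si.
  apply: low_im => //; rewrite /lower_tgt wi; case/andP: ui => -> _ //.
apply/open_targetsP; split=> // [|j uj ltij]; last first.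
  by apply: contra s_im => /eqP <-; apply/imsetP; exists j; rewrite ?inE.
case ws: (w s) => [v|]; last first.
  case/negP: s_im; apply/imsetP; exists s; rewrite ?inE //.
  by have := valid_above s lt_is; rewrite /valid_at ws /= => /eqP->.
rewrite /upper_tgt ws; apply: contraR s_im => ne.
apply: low_im; last exact: ltnW.
by rewrite /lower_tgt ws; apply: contraR ne; case: (v); case: odd_index.
Qed.

Lemma lower_open_upd f i j b : ~~ (lower_src i && (i < j)%N) ->
  lower_open (upd f i b) j = lower_open f j.
Proof.
move=> H; apply: eq_open_targets => k lk ltk; rewrite upd_other //.
by apply: contraNneq H => <-; rewrite lk.
Qed.

Lemma upper_open_upd f i j b : ~~ (upper_src i && (j < i)%N) ->
  upper_open (upd f i b) j = upper_open f j.
Proof.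
move=> H; apply: eq_open_targets => k lk ltk; rewrite upd_other //.
by apply: contraNneq H => <-; rewrite lk.
Qed.

Lemma chain_start_upd f i j b : ~~ (j < i)%N ->
  chain_start (upd f i b) (above j) j = chain_start f (above j) j.
Proof.
move=> H; apply: eq_chain_start => k; rewrite inE => ltk; rewrite upd_other //.
by apply: contraNneq H => <-.
Qed.

Lemma key_lt_upper i j : upper_src j -> (choice_key j < choice_key i)%N -> ~~ (j < i)%N.
Proof.
move=> uj; have [ui | nui] := boolP (upper_src i).
  by rewrite key_upper // -leqNgt; apply: ltnW.
by rewrite ltnNge ltnW // key_lower_upper.
Qed.

Lemma key_lt_lower i j : lower_src j -> (choice_key j < choice_key i)%N ->
  ~~ (lower_src i && (i < j)%N).
Proof.
move=> lj lt; apply/negP => /andP[li ltij]; move: lt.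
by rewrite key_lower ?lower_srcN // ltnNge ltnW.
Qed.

End WordStructure.

Section WordExtensionality.
Variables (N : nat) (w w' : 'I_N -> letter).
Hypothesis ww' : w =1 w'.

(** The word of a permutation and its tuple agree only pointwise, hence the need for
    extensionality. *)
Lemma eq_upper_open f i : upper_open w f i = upper_open w' f i.
Proof.
apply/setP => b; rewrite !inE /upper_tgt ww'; do 2!congr (_ && _).
by apply: eq_forallb => j; rewrite /upper_src ww'.
Qed.

Lemma eq_lower_open f i : lower_open w f i = lower_open w' f i.
Proof.
apply/setP => b; rewrite !inE /lower_tgt ww'; do 2!congr (_ && _).
by apply: eq_forallb => j; rewrite /lower_src ww'.
Qed.

Lemma eq_valid_at f i : valid_at w f i = valid_at w' f i.
Proof. by rewrite /valid_at ww' eq_upper_open eq_lower_open. Qed.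

End WordExtensionality.

(** * Weights of words *)

Section Weights.
Variable R : comNzRingType.

(** An upper (lower) arc has [nest] zero exactly when its source is an exclusive record
    (antirecord); see [record_upper] and [antirecord_lower]. *)
Definition arc_weight (x u p q : R) (cross nest : nat) : R :=
  (if nest == 0%N then x else u) * p ^+ cross * q ^+ nest.

Definition arc_sum (x u p q : R) (h : nat) : R :=
  \sum_(r < h) arc_weight x u p q (h.-1 - r) r.

Lemma arc_sum0 x u p q : arc_sum x u p q 0 = 0.
Proof. exact: big_ord0. Qed.

Lemma arc_sumS x u p q h :
  arc_sum x u p q h.+1 = p ^+ h * x + q * pqint h p q * u.
Proof.
rewrite /arc_sum big_ord_recl /arc_weight /= subn0 mulr1 mulrC; congr (_ + _).
rewrite /pqint mulr_sumr mulr_suml; apply: eq_bigr => i _.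
rewrite /bump /= add1n exprS (_ : h - i.+1 = h - 1 - i)%N; last by lia.
by ring.
Qed.

(* Lower arcs carry the weights [xl ul pl ql], where [true] stands for peaks and
   [false] for double falls; upper arcs carry [xu uu pu qu], where [true] stands
   for valleys and [false] for double rises; fixed points carry [wf zf sf],
   where [true] stands for odd ones. *)
Variables (xl ul pl ql xu uu pu qu wf zf sf : bool -> R) (lam : R).

(** A fixed point is a cycle by itself, and [h] will be its [psnest], which vanishes exactly at
    record-antirecords. *)
Definition fix_weight (o : bool) (h : nat) : R :=
  lam * (if h == 0%N then zf o else wf o * sf o ^+ h).

Definition step_weight (o : bool) (a : letter) (h : nat) : R :=
  if a is Some v then
    if o then
      if v then (lam + h%:R) * pu true ^+ h * xu true
      else arc_sum (xu v) (uu v) (pu v) (qu v) h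
    else arc_sum (xl v) (ul v) (pl v) (ql v) h
  else fix_weight o h.

(** The membership factors give invalid choices weight 0, so that sums may range over all
    functions. *)
Definition index_weight N (w : 'I_N -> letter) i (f : {ffun 'I_N -> 'I_N}) : R :=
  if w i is Some v then
    if odd_index i then
      let U := upper_open w f i in
      (f i \in U)%:R *
      (arc_weight (xu v) (uu v) (pu v) (qu v)
         #|[set x in U | ord_gt (f i) x]| #|[set x in U | ord_gt x (f i)]|
       * (if v && (f i == chain_start f (above i) i) then lam else 1))
    else
      let U := lower_open w f i in
      (f i \in U)%:R *
      arc_weight (xl v) (ul v) (pl v) (ql v)
        #|[set x in U | ord_lt (f i) x]| #|[set x in U | ord_lt x (f i)]|
  else (f i == i)%:R * fix_weight (odd_index i) (height true 0 w i).

Lemma index_weight_invalid N (w : 'I_N -> letter) i f :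
  ~~ valid_at w f i -> index_weight w i f = 0.
Proof.
rewrite /valid_at /index_weight; case: (w i) => [v|] /=; last first.
  by move=> /negbTE->; rewrite mul0r.
by case: odd_index => /negbTE->; rewrite mul0r.
Qed.

Lemma eq_index_weight N (w w' : 'I_N -> letter) i f : w =1 w' ->
  index_weight w i f = index_weight w' i f.
Proof.
move=> ww'; rewrite /index_weight -ww' (eq_upper_open ww') (eq_lower_open ww').
by rewrite (eq_height _ _ _ ww').
Qed.

Lemma index_weight_upd N (w : 'I_N -> letter) i j b f :
  (choice_key w j < choice_key w i)%N ->
  index_weight w j (upd f i b) = index_weight w j f.
Proof.
move=> lt_key; rewrite /index_weight.
have -> : upd f i b j = f j.
  by rewrite upd_other //; apply: contraTneq lt_key => ->; rewrite ltnn.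
case wj: (w j) => [v|] //; case: ifPn => oj.
  have uj : upper_src w j by rewrite /upper_src oj wj.
  have nlt := key_lt_upper uj lt_key.
  by rewrite upper_open_upd ?chain_start_upd // (negbTE nlt) andbF.
have lj : lower_src w j by rewrite /lower_src oj wj.
by rewrite lower_open_upd // (key_lt_lower lj).
Qed.

Lemma sum_indicator (I : finType) (S : {set I}) (F : I -> R) :
  \sum_b (b \in S)%:R * F b = \sum_(b in S) F b.
Proof.
rewrite [RHS]big_mkcond; apply: eq_bigr => b _.
by case: ifP; rewrite ?mul1r ?mul0r.
Qed.

Lemma sum_upper_rank N (S : {set 'I_N}) x u p q :
  \sum_(b in S) arc_weight x u p q #|[set x in S | ord_gt b x]|
     #|[set x in S | ord_gt x b]| = arc_sum x u p q #|S|.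
Proof.
exact: (rank_sum (@ord_gt_irr N) (@ord_gt_trans N) (@ord_gt_total N)).
Qed.

Lemma sum_lower_rank N (S : {set 'I_N}) x u p q :
  \sum_(b in S) arc_weight x u p q #|[set x in S | ord_lt b x]|
     #|[set x in S | ord_lt x b]| = arc_sum x u p q #|S|.
Proof.
exact: (rank_sum (@ord_lt_irr N) (@ord_lt_trans N) (@ord_lt_total N)).
Qed.

Hypothesis uu_valley : uu true = xu true.
Hypothesis qu_valley : qu true = pu true.

(* Once crossings and nestings weigh the same, all choices at a valley have the
   same weight but for the factor [lam] of the one that closes a cycle. *)
Lemma sum_valley N (S : {set 'I_N}) t : t \in S ->
  \sum_(b in S) arc_weight (xu true) (uu true) (pu true) (qu true)
     #|[set x in S | ord_gt b x]| #|[set x in S | ord_gt x b]|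
     * (if b == t then lam else 1)
  = (lam + #|S|.-1%:R) * pu true ^+ #|S|.-1 * xu true.
Proof.
move=> tS; have cardS b : b \in S ->
    (#|[set x in S | ord_gt b x]| + #|[set x in S | ord_gt x b]| = #|S|.-1)%N.
  move=> bS; rewrite [#|S|](cardsD1 b) bS add1n /=.
  rewrite -(cardsID [set x | ord_gt b x] (S :\ b)); congr (_ + _)%N.
    congr #|pred_of_set _|; apply/setP => x; rewrite !inE /ord_gt.
    by case: eqVneq => [->|] //; rewrite ltnn !andbF.
  congr #|pred_of_set _|; apply/setP => x; rewrite !inE /ord_gt -leqNgt.
  case: (eqVneq x b) => [->|ne]; first by rewrite ltnn !andbF.
  by rewrite ltn_neqAle (inj_eq (@ord_inj N)) eq_sym ne /= andbC.
under eq_bigr => b bS.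
  rewrite /arc_weight uu_valley qu_valley if_same -(mulrA (xu true)) -exprD cardS //.
  over.
rewrite -mulr_sumr (bigD1 t) //= eqxx.
rewrite (eq_bigr (fun=> 1)) => [|b /andP[_ /negbTE->] //].
rewrite -big_filter -(eq_filter (a1 := fun b => b \in S :\ t)); last first.
  by move=> b; rewrite !inE andbC.
by rewrite big_filter sumr_const [#|S|](cardsD1 t) tS add1n /=; ring.
Qed.

Lemma sum_index_weight N (w : 'I_N -> letter) : balanced_word w ->
  \sum_f \prod_i index_weight w i f =
  \prod_(i < N) step_weight (odd_index i) (w i) (height true 0 w i).
Proof.
move=> bal; apply: (sequential_sum (key := choice_key w)).
- exact: choice_key_inj.
- by move=> i j b f; apply: index_weight_upd.
(* A past containing an invalid choice has weight 0, so the choices at [i] need be summed only after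
   a valid past. *)
move=> i f past; have [/forallP valid_f | ] :=
  boolP [forall j, (choice_key w j < choice_key w i)%N ==> valid_at w f j]; last first.
  case/forallPn => j; rewrite negb_imply => /andP[lt_key nvalid].
  by rewrite /past (bigD1 j) //= index_weight_invalid // !mul0r.
congr (_ * _).
have {}valid_f j : (choice_key w j < choice_key w i)%N -> valid_at w f j.
  by move=> lt_key; apply: (implyP (valid_f j)).
rewrite /index_weight /step_weight /height add0n.
case wi: (w i) => [v|]; last first.
  under eq_bigr do rewrite upd_same.
  by rewrite (bigD1 i) //= eqxx mul1r big1 ?addr0 // => b /negbTE->; rewrite mul0r.
case: ifPn => oi.
  have ui : upper_src w i by rewrite /upper_src oi wi.
  under eq_bigr => b _.
    rewrite upd_same upper_open_upd ?ltnn ?andbF // chain_start_upd ?ltnn //.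
    over.
  rewrite sum_indicator.
  have card_open : (#|upper_open w f i| + peaks true w i.+1 = valleys true w i.+1)%N.
    apply: upper_open_card => // j uj ltj; apply: valid_f; by rewrite key_upper.
  have le_pv := peaks_le i bal.
  have VS : valleys true w i.+1 = (valleys true w i + v)%N.
    rewrite /valleys (bigD1 i) // [in RHS](bigD1 i) //= (oi : ~~ odd i) wi ltnSn ltnn.
    rewrite andbF add0n addnC; congr (_ + _)%N; last by case: (v).
    by apply: eq_bigr => j ne; rewrite ltnS leq_eqVlt (inj_eq (@ord_inj N)) (negbTE ne).
  have PS : peaks true w i.+1 = peaks true w i.
    rewrite /peaks (bigD1 i) // [in RHS](bigD1 i) //= (oi : ~~ odd i).
    congr (_ + _)%N.
    by apply: eq_bigr => j ne; rewrite ltnS leq_eqVlt (inj_eq (@ord_inj N)) (negbTE ne).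
  case: v wi VS => wi; rewrite /= ?addn0 ?addn1 => VS.
    rewrite sum_valley; last by apply: chain_start_open.
    rewrite (_ : #|_|.-1 = valleys true w i - peaks true w i)%N //.
    by rewrite -(addnK (peaks true w i) #|_|) -{1}PS card_open VS subSn.
  under eq_bigr do rewrite /= mulr1.
  rewrite sum_upper_rank; congr arc_sum.
  by rewrite -(addnK (peaks true w i) #|_|) -{1}PS card_open VS.
have li : lower_src w i by rewrite /lower_src oi wi.
under eq_bigr => b _.
  rewrite upd_same lower_open_upd ?ltnn ?andbF //.
  over.
rewrite sum_indicator sum_lower_rank; congr arc_sum.
rewrite -(@lower_open_card _ _ f) ?addnK // => j lj ltj.
by apply: valid_f; rewrite key_lower ?lower_srcN.
Qed.

End Weights.

(** * Words of D-permutations *)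

Lemma set0NP (T : finType) (A : {set T}) : reflect (~ exists x, x \in A) (A == set0).
Proof.
apply: (iffP idP) => [/eqP-> [x] | no_x]; first by rewrite inE.
by apply: contraT => /set0Pn.
Qed.

Section Permutations.
Variables (N : nat) (s : 'S_N).
Implicit Types i j x : 'I_N.

Definition perm_word i : letter :=
  if s i == i then None else Some ((i < (s^-1)%g i)%N == odd_index i).

Lemma card_perm (P : pred 'I_N) : #|[set i | P (s i)]| = #|[set i | P i]|.
Proof.
rewrite -(card_imset [set i | P (s i)] (@perm_inj _ s)).
congr #|pred_of_set _|; apply/setP => x; rewrite inE.
apply/imsetP/idP => [[i] | Px]; first by rewrite inE => Pi ->.
by exists ((s^-1)%g x); rewrite ?inE permKV.
Qed.

Lemma card_permV (P : pred 'I_N) : #|[set i | P ((s^-1)%g i)]| = #|[set i | P i]|.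
Proof.
rewrite -(card_perm (fun i => P ((s^-1)%g i))).
by congr #|pred_of_set _|; apply/setP => x; rewrite !inE permK.
Qed.

(** Adding the indices that stay below [k] completes the two sets to the indices below [k] and their
    preimage under [s], which are equinumerous. *)
Lemma card_cut (k : nat) :
  #|[set j : 'I_N | (j < k)%N && (k <= s j)%N]| =
  #|[set j : 'I_N | (k <= j)%N && (s j < k)%N]|.
Proof.
have := card_perm (fun j => (j < k)%N); rewrite !card_sumb => E.
apply/eqP; rewrite -(eqn_add2r (\sum_(j < N) ((j < k)%N && (s j < k)%N))).
rewrite -!big_split /=; apply/eqP; transitivity (\sum_(j < N) (j < k)%N)%N.
  by apply: eq_bigr => j _; case: (ltnP j k) => //=; case: (ltnP (s j) k).
rewrite -E; apply: eq_bigr => j _.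
by case: (ltnP j k) => //=; case: (ltnP (s j) k).
Qed.

Lemma jump_left_of i : (s i < i)%N -> exists2 j : 'I_N, (j < i)%N & (i <= s j)%N.
Proof.
move=> lt_si; have: [set j : 'I_N | (j < i)%N && (i <= s j)%N] != set0.
  rewrite -card_gt0 card_cut card_gt0; apply/set0Pn; exists i.
  by rewrite inE leqnn.
by case/set0Pn => j; rewrite inE => /andP[]; exists j.
Qed.

Lemma jump_right_of i : (i < s i)%N -> exists2 j : 'I_N, (i < j)%N & (s j <= i)%N.
Proof.
move=> lt_si; have: [set j : 'I_N | (i.+1 <= j)%N && (s j < i.+1)%N] != set0.
  rewrite -card_gt0 -card_cut card_gt0; apply/set0Pn; exists i.
  by rewrite inE ltnSn.
by case/set0Pn => j; rewrite inE => /andP[]; exists j.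
Qed.

(** Some index jumps over the cut at [i] from the left and spoils the record. At peaks and double
    falls, antirecords are therefore automatically exclusive. *)
Lemma record_lower i : (s i < i)%N -> record s i = false.
Proof.
move=> lti; have [j ltj le_sj] := jump_left_of lti.
by apply/forallP => /(_ j); rewrite ltj /= ltnNge ltnW // (leq_trans lti).
Qed.

Lemma antirecord_upper i : (i < s i)%N -> antirecord s i = false.
Proof.
move=> lti; have [j ltj le_sj] := jump_right_of lti.
by apply/forallP => /(_ j); rewrite ltj /= ltnNge ltnW // (leq_ltn_trans le_sj).
Qed.

Lemma permV_ne i x : s i != x -> (s^-1)%g x != i.
Proof. by apply: contraNneq => <-; rewrite permKV. Qed.

Lemma permV_ltE i x : (s i < x)%N || (x < s i)%N ->
  ((s^-1)%g x <= i)%N = ((s^-1)%g x < i)%N.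
Proof.
move=> ne; rewrite ltn_neqAle -[_ != _ :> nat]/((s^-1)%g x != i) permV_ne //.
by rewrite -(inj_eq (@ord_inj N)) neq_ltn.
Qed.

Lemma permV_gtE i x : (s i < x)%N || (x < s i)%N ->
  (i <= (s^-1)%g x)%N = (i < (s^-1)%g x)%N.
Proof.
move=> ne; rewrite ltn_neqAle eq_sym -[_ != _ :> nat]/((s^-1)%g x != i) permV_ne //.
by rewrite -(inj_eq (@ord_inj N)) neq_ltn.
Qed.

Lemma card_triples (A : {set 'I_N}) (F : 'I_N -> 'I_N * 'I_N * 'I_N)
    (P : pred ('I_N * 'I_N * 'I_N)) : injective F ->
    (forall x, x \in A -> P (F x)) ->
    (forall t, P t -> exists2 x, x \in A & t = F x) ->
  #|[set t | P t]| = #|A|.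
Proof.
move=> F_inj AP PA; rewrite -(card_imset A F_inj); congr #|pred_of_set _|.
apply/setP => t; rewrite inE; apply/idP/imsetP => [/PA[x] | [x /AP Px ->]] //.
by exists x.
Qed.

(** A crossing triple is determined by [k] alone. The preimage is compared by [<=] so that the set
    consists of open targets of [j], as described by [perm_upper_open]. *)
Lemma ucrossE j : ucross s j =
  #|[set x : 'I_N | [&& (j < x)%N, ((s^-1)%g x <= j)%N & (x < s j)%N]]|.
Proof.
apply: (card_triples (F := fun x => ((s^-1)%g x, x, s j))).
- by move=> x y [].
- move=> x; rewrite inE => /and3P[jx xj xs].
  by rewrite permKV !eqxx jx xs -permV_ltE ?xj // xs orbT.
move=> [[i k] l] /and5P[ij jk kl /eqP Ek /eqP El]; exists k.
  by rewrite inE jk -El kl Ek permK ltnW.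
by rewrite Ek permK -El.
Qed.

Lemma unestE j : (j < s j)%N -> unest s j =
  #|[set x : 'I_N | [&& (j < x)%N, ((s^-1)%g x <= j)%N & (s j < x)%N]]|.
Proof.
move=> jsj; apply: (card_triples (F := fun x => ((s^-1)%g x, s j, x))).
- by move=> x y [].
- move=> x; rewrite inE => /and3P[jx xj xs].
  by rewrite permKV !eqxx xs jsj -permV_ltE ?xj // xs.
move=> [[i k] l] /and5P[ij jk kl /eqP Ek /eqP El]; exists l.
  by rewrite inE -Ek (ltn_trans jk) // kl El permK ltnW.
by rewrite El permK -Ek.
Qed.

Lemma lcrossE k : lcross s k =
  #|[set x : 'I_N | [&& (x < k)%N, (k <= (s^-1)%g x)%N & (s k < x)%N]]|.
Proof.
apply: (card_triples (F := fun x => (s k, x, (s^-1)%g x))).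
- by move=> x y [].
- move=> x; rewrite inE => /and3P[xk kx xs].
  by rewrite permKV !eqxx xk xs -permV_gtE ?kx // xs.
move=> [[i j] l] /and5P[ij jk kl /eqP Ei /eqP Ej]; exists j.
  by rewrite inE jk -Ei ij Ej permK ltnW.
by rewrite Ej permK -Ei.
Qed.

Lemma lnestE k : (s k < k)%N -> lnest s k =
  #|[set x : 'I_N | [&& (x < k)%N, (k <= (s^-1)%g x)%N & (x < s k)%N]]|.
Proof.
move=> ksk; apply: (card_triples (F := fun x => (x, s k, (s^-1)%g x))).
- by move=> x y [].
- move=> x; rewrite inE => /and3P[xk kx xs].
  by rewrite permKV !eqxx xs ksk -permV_gtE ?kx // xs orbT.
move=> [[i j] l] /and5P[ij jk kl /eqP Ei /eqP Ej]; exists i.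
  by rewrite inE -Ej (ltn_trans ij) // ij Ei permK ltnW.
by rewrite Ei permK -Ej.
Qed.

Lemma record_upper j : (j < s j)%N -> record s j = (unest s j == 0%N).
Proof.
move=> jsj; rewrite unestE // cards_eq0.
apply/forallP/set0NP => [rec [x] | no_x i].
  rewrite inE => /and3P[jx xj xs]; have := implyP (rec ((s^-1)%g x)).
  rewrite -permV_ltE ?xs // xj permKV => /(_ isT); by rewrite ltnNge ltnW.
apply/implyP => ij; rewrite ltnNge; apply/negP => le_sj; apply: no_x; exists (s i).
rewrite inE permK (ltnW ij) /= (leq_trans jsj le_sj) ltn_neqAle le_sj andbT.
by rewrite -[_ != _ :> nat]/(s j != s i) (inj_eq perm_inj); apply: contraTneq ij => ->; rewrite ltnn.
Qed.

Lemma antirecord_lower k : (s k < k)%N -> antirecord s k = (lnest s k == 0%N).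
Proof.
move=> ksk; rewrite lnestE // cards_eq0.
apply/forallP/set0NP => [rec [x] | no_x i].
  rewrite inE => /and3P[jx xj xs]; have := implyP (rec ((s^-1)%g x)).
  rewrite -permV_gtE ?xs ?orbT // xj permKV => /(_ isT); by rewrite ltnNge ltnW.
apply/implyP => ij; rewrite ltnNge; apply/negP => le_sj; apply: no_x; exists (s i).
rewrite inE permK (ltnW ij) /= (leq_ltn_trans le_sj ksk) ltn_neqAle le_sj andbT.
by rewrite -[_ != _ :> nat]/(s i != s k) (inj_eq perm_inj); apply: contraTneq ij => ->; rewrite ltnn.
Qed.

Lemma psnestE i : s i = i ->
  psnest s i = #|[set x : 'I_N | (i < x)%N && ((s^-1)%g x <= i)%N]|.
Proof.
move=> si; rewrite /psnest -(card_permV (fun j => (j < i)%N && (i < s j)%N)).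
congr #|pred_of_set _|; apply/setP => x; rewrite !inE permKV andbC.
by case: ltnP => //= ltix; rewrite permV_ltE // si ltix.
Qed.

(** This is [card_cut] at [i], where the fixed point itself crosses neither way. It makes records
    and antirecords coincide among fixed points. *)
Lemma psnest_right i : s i = i -> psnest s i = #|[set j : 'I_N | (i < j)%N && (s j < i)%N]|.
Proof.
move=> si; transitivity #|[set j : 'I_N | (j < i)%N && (i <= s j)%N]|.
  congr #|pred_of_set _|; apply/setP => j; rewrite !inE.
  case: ltnP => //= ltj; rewrite [RHS]leq_eqVlt; case: eqP => //= /ord_inj e.
  by move: ltj; rewrite (@perm_inj _ s j i) ?ltnn // si.
rewrite card_cut; congr #|pred_of_set _|; apply/setP => j; rewrite !inE leq_eqVlt.
case: eqP => //= /ord_inj <-; by rewrite si ltnn.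
Qed.

Lemma record_fix i : s i = i -> record s i = (psnest s i == 0%N).
Proof.
move=> si; rewrite /psnest cards_eq0; apply/forallP/set0NP => [rec [x] | no_x j].
  rewrite inE => /andP[ltxi ltix]; have := implyP (rec x) ltxi.
  by rewrite si ltnNge ltnW.
apply/implyP => ltj; rewrite si ltnNge; apply/negP => le_i; apply: no_x; exists j.
rewrite inE ltj /= ltn_neqAle le_i andbT -{1}si.
by rewrite -[_ != _ :> nat]/(s i != s j) (inj_eq perm_inj); apply: contraTneq ltj => ->; rewrite ltnn.
Qed.

Lemma antirecord_fix i : s i = i -> antirecord s i = (psnest s i == 0%N).
Proof.
move=> si; rewrite psnest_right // cards_eq0; apply/forallP/set0NP => [rec [x] | no_x j].
  rewrite inE => /andP[ltxi ltix]; have := implyP (rec x) ltxi.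
  by rewrite si ltnNge ltnW.
apply/implyP => ltj; rewrite si ltnNge; apply/negP => le_i; apply: no_x; exists j.
rewrite inE ltj /= ltn_neqAle le_i andbT -{1}si.
by rewrite -[_ != _ :> nat]/(s j != s i) (inj_eq perm_inj); apply: contraTneq ltj => ->; rewrite ltnn.
Qed.

Lemma cycle_min_fix i : s i = i -> cycle_min s i.
Proof.
move=> si; apply/forallP => j; apply/implyP => /porbitP[k ->].
suff -> : (s ^+ k)%g i = i by [].
by elim: k => [|k IHk]; rewrite ?expg0 ?perm1 // expgSr permM IHk.
Qed.

Lemma cycle_min_le i : cycle_min s i -> (i <= s i)%N /\ (i <= (s^-1)%g i)%N.
Proof.
move=> /forallP min_i; split; apply: (implyP (min_i _)).
  exact: (mem_porbit s 1).
by rewrite porbit_sym -[X in X \in _](permKV s); exact: (mem_porbit s 1).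
Qed.

Hypothesis s_D : forall i, if odd_index i then (i <= s i)%N else (s i <= i)%N.
Let w := perm_word.
Let f : {ffun 'I_N -> 'I_N} := [ffun i => s i].

Lemma perm_upper_src i : upper_src w i = (i < s i)%N.
Proof.
rewrite /upper_src /w /perm_word; have := s_D i.
rewrite -(inj_eq (@ord_inj N)).
by case: odd_index; case: (ltngtP (s i) i).
Qed.

Lemma perm_lower_src i : lower_src w i = (s i < i)%N.
Proof.
rewrite /lower_src /w /perm_word; have := s_D i.
rewrite -(inj_eq (@ord_inj N)).
by case: odd_index; case: (ltngtP (s i) i).
Qed.

Lemma permV_fix i : ((s^-1)%g i == i) = (s i == i).
Proof. by apply/eqP/eqP => {1}<-; rewrite ?permKV ?permK. Qed.

Lemma perm_upper_tgt i : upper_tgt w i = ((s^-1)%g i < i)%N.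
Proof.
rewrite /upper_tgt /w /perm_word -permV_fix -(inj_eq (@ord_inj N)).
by case: (ltngtP ((s^-1)%g i) i); case: odd_index.
Qed.

Lemma perm_lower_tgt i : lower_tgt w i = (i < (s^-1)%g i)%N.
Proof.
rewrite /lower_tgt /w /perm_word -permV_fix -(inj_eq (@ord_inj N)).
by case: (ltngtP ((s^-1)%g i) i); case: odd_index.
Qed.

Lemma perm_upper_open i :
  upper_open w f i = [set x : 'I_N | (i < x)%N && ((s^-1)%g x <= i)%N].
Proof.
apply/setP => x; rewrite [RHS]inE; apply/open_targetsP/andP.
  case=> tx ltx no_j; split=> //; rewrite leqNgt; apply/negP => lti.
  move: tx; rewrite perm_upper_tgt => ltxx.
  by have := no_j ((s^-1)%g x); rewrite ffunE permKV eqxx perm_upper_src permKV => /(_ ltxx lti).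
case=> ltx le_i; split=> //; first by rewrite perm_upper_tgt (leq_ltn_trans le_i).
move=> j _ ltj; rewrite ffunE; apply: contraTneq le_i => <-.
by rewrite permK -ltnNge.
Qed.

Lemma perm_lower_open i :
  lower_open w f i = [set x : 'I_N | (x < i)%N && (i <= (s^-1)%g x)%N].
Proof.
apply/setP => x; rewrite [RHS]inE; apply/open_targetsP/andP.
  case=> tx ltx no_j; split=> //; rewrite leqNgt; apply/negP => lti.
  move: tx; rewrite perm_lower_tgt => ltxx.
  by have := no_j ((s^-1)%g x); rewrite ffunE permKV eqxx perm_lower_src permKV => /(_ ltxx lti).
case=> ltx le_i; split=> //; first by rewrite perm_lower_tgt (leq_trans ltx).
move=> j _ ltj; rewrite ffunE; apply: contraTneq le_i => <-.
by rewrite permK -ltnNge.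
Qed.

Lemma perm_valid i : valid_at w f i.
Proof.
rewrite /valid_at ffunE perm_upper_open perm_lower_open.
have := s_D i; rewrite {1}/w {1}/perm_word.
case: (eqVneq (s i) i) => [-> //|ne] /=; rewrite -(inj_eq (@ord_inj N)) in ne.
by case: odd_index => le; rewrite inE permK leqnn andbT ltn_neqAle le andbT ?ne // eq_sym ne.
Qed.

(** Valleys minus peaks before an index is a number of open targets, hence nonnegative; the final
    equality holds because [s] maps lower sources bijectively onto lower targets. *)
Lemma perm_balanced : balanced_word w.
Proof.
have total : (valleys true w N = peaks true w N).
  have : #|[set j | lower_src w j]| = #|[set j | lower_tgt w j]|.
    rewrite -(card_perm (lower_tgt w)); congr #|pred_of_set _|; apply/setP => j.
    by rewrite !inE perm_lower_src perm_lower_tgt permK.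
  rewrite !card_sumb; pose falls := (\sum_(j < N) [&& ~~ odd_index j & w j == Some false])%N.
  have -> : (\sum_j lower_src w j = peaks true w N + falls)%N.
    rewrite -big_split; apply: eq_bigr => j _; rewrite /lower_src odd_indexE ltn_ord /=.
    by case: (odd j); case: (w j) => [[]|].
  have -> : (\sum_j lower_tgt w j = valleys true w N + falls)%N.
    rewrite -big_split; apply: eq_bigr => j _; rewrite /lower_tgt odd_indexE ltn_ord /=.
    by case: (odd j); case: (w j) => [[]|].
  by move/addIn->.
rewrite /balanced_word /balanced total eqxx andbT; apply/forallP => k; rewrite add0n.
have [ltk | ] := ltnP k N; last first.
  move=> leNk; suff -> : k = N :> nat by rewrite total.
  by apply/eqP; rewrite eqn_leq leNk -ltnS ltn_ord.
have := @lower_open_card N w f (Ordinal ltk) (fun j _ _ => perm_valid j).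
by move=> /= <-; rewrite leq_addl.
Qed.

Lemma perm_height i : s i = i -> height true 0 w i = psnest s i.
Proof.
move=> si; rewrite psnestE // -perm_upper_open.
have wi : w i = None by rewrite /w /perm_word si eqxx.
have := upper_open_card perm_balanced (fun j _ _ => perm_valid j) (i := i).
rewrite /height add0n.
have -> : valleys true w i.+1 = valleys true w i.
  apply: eq_bigr => j _; rewrite ltnS leq_eqVlt (inj_eq (@ord_inj N)).
  by case: (eqVneq j i) => [-> | //]; rewrite wi !andbF.
have -> : peaks true w i.+1 = peaks true w i.
  apply: eq_bigr => j _; rewrite ltnS leq_eqVlt (inj_eq (@ord_inj N)).
  by case: (eqVneq j i) => [-> | //]; rewrite wi !andbF.
by move=> <-; rewrite addnK.
Qed.

End Permutations.

(** The converse of [perm_valid]: together they identify D-permutations with words equipped with a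
    valid choice. *)
Lemma valid_word N (w : 'I_N -> letter) (f : {ffun 'I_N -> 'I_N}) :
    (forall i, valid_at w f i) ->
  exists s : 'S_N, [/\ f = [ffun i => s i], perm_word s =1 w
    & forall i, if odd_index i then (i <= s i)%N else (s i <= i)%N].
Proof.
move=> valid_f; have f_inj : injective f.
  by move=> i j; apply: (valid_inj (J := xpredT) (fun j _ => valid_f j)).
have s_f i : perm f_inj i = f i by rewrite permE.
exists (perm f_inj); split; first by apply/ffunP => i; rewrite ffunE s_f.
  move=> i; rewrite /perm_word; pose m := ((perm f_inj)^-1)%g i.
  have fm : f m = i by rewrite -s_f permKV.
  rewrite -/m -permV_fix -/m -(inj_eq (@ord_inj N)).
  have [wm fmm | um om | lm om] := validP (valid_f m).
  - by rewrite -fm fmm eqxx wm.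
  - case/open_targetsP => /eqP; rewrite fm => -> ltm _; rewrite -/m.
    by move: ltm; rewrite /ord_gt; case: ltngtP.
  case/open_targetsP => /eqP; rewrite fm => -> ltm _; rewrite -/m.
  by move: ltm; rewrite /ord_lt; case: ltngtP; case: odd_index.
move=> i; rewrite s_f; have [wi -> | ui -> | li /negbTE->] := validP (valid_f i).
- by rewrite leqnn if_same.
- by case/open_targetsP => _ /ltnW.
by case/open_targetsP => _ /ltnW.
Qed.

(** * The generating polynomial as a sum over words *)

Lemma expr_card (R : comNzRingType) (I : finType) (x : R) (P : pred I) :
  x ^+ #|[set i | P i]| = \prod_i x ^+ P i.
Proof.
by rewrite prodrXr -sum1dep_card big_mkcond; congr (_ ^+ _).
Qed.

Lemma expr_sum_if (R : comNzRingType) (I : finType) (x : R) (P : pred I) F :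
  x ^+ (\sum_(i | P i) F i) = \prod_i (if P i then x ^+ F i else 1).
Proof. by rewrite -prodrXr big_mkcond. Qed.

Section DPermutations.
Variables (R : comNzRingType).
Variables (x1 x2 y1 y2 u1 u2 v1 v2 we wo ze zo
     pm1 pm2 pp1 pp2 qm1 qm2 qp1 qp2 se so lam : R).

Let sel (a b : R) (v : bool) : R := if v then a else b.

Let weight N (w : 'I_N -> letter) i f :=
  index_weight (sel x1 x2) (sel u1 u2) (sel pm1 pm2) (sel qm1 qm2)
    (sel y1 y2) (sel v1 v2) (sel pp1 pp2) (sel qp1 qp2)
    (sel wo we) (sel zo ze) (sel so se) lam w i f.

Lemma local_weight N (s : 'S_N) i :
    (forall i, if odd_index i then (i <= s i)%N else (s i <= i)%N) ->
  x1 ^+ (cpeak s i && earec s i) * x2 ^+ (cdfall s i && earec s i)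
  * y1 ^+ (cval s i && erec s i) * y2 ^+ (cdrise s i && erec s i)
  * u1 ^+ (cpeak s i && nrar s i) * u2 ^+ (cdfall s i && nrar s i)
  * v1 ^+ (cval s i && nrar s i) * v2 ^+ (cdrise s i && nrar s i)
  * we ^+ [&& even_index i, fix_index s i & nrar s i]
  * wo ^+ [&& odd_index i, fix_index s i & nrar s i]
  * ze ^+ (even_index i && rar s i) * zo ^+ (odd_index i && rar s i)
  * (if cpeak s i then pm1 ^+ lcross s i else 1)
  * (if cdfall s i then pm2 ^+ lcross s i else 1)
  * (if cval s i then pp1 ^+ ucross s i else 1)
  * (if cdrise s i then pp2 ^+ ucross s i else 1)
  * (if cpeak s i then qm1 ^+ lnest s i else 1)
  * (if cdfall s i then qm2 ^+ lnest s i else 1)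
  * (if cval s i then qp1 ^+ unest s i else 1)
  * (if cdrise s i then qp2 ^+ unest s i else 1)
  * (if even_index i && fix_index s i then se ^+ psnest s i else 1)
  * (if odd_index i && fix_index s i then so ^+ psnest s i else 1)
  * lam ^+ cycle_min s i
  = weight (perm_word s) i [ffun j => s j].
Proof.
move=> s_D; have := s_D i; have valid_i := perm_valid s_D i.
rewrite /weight /index_weight /even_index -/(odd_index i).
rewrite perm_upper_open // perm_lower_open // !ffunE.
rewrite /cpeak /cval /cdrise /cdfall /earec /erec /nrar /rar /fix_index.
have Vne := permV_fix s i; rewrite -!(inj_eq (@ord_inj N)) in Vne.
have word_i : perm_word s i = if s i == i then None
   else Some ((i < (s^-1)%g i)%N == odd_index i) by [].
case: (ltngtP (s i) i) => [lt_si | gt_si | /ord_inj si].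
- case: ifP => // oi _.
  have ne : (s i == i) = false by rewrite -(inj_eq (@ord_inj N)) ltn_eqF.
  have nmin : cycle_min s i = false.
    by apply/negP => /cycle_min_le[]; rewrite leqNgt lt_si.
  rewrite word_i ne oi nmin record_lower // antirecord_lower //.
  have -> : s i \in [set x : 'I_N | (x < i)%N && (i <= (s^-1)%g x)%N].
    by rewrite inE lt_si permK leqnn.
  rewrite /arc_weight.
  have -> : #|[set x in [set x : 'I_N | (x < i)%N && (i <= (s^-1)%g x)%N] | ord_lt (s i) x]| = lcross s i.
    by rewrite lcrossE; congr #|pred_of_set _|; apply/setP => x; rewrite !inE andbA.
  have -> : #|[set x in [set x : 'I_N | (x < i)%N && (i <= (s^-1)%g x)%N] | ord_lt x (s i)]| = lnest s i.
    by rewrite lnestE //; congr #|pred_of_set _|; apply/setP => x; rewrite !inE andbA.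
  move: Vne; rewrite (ltn_eqF lt_si).
  by case: ltngtP => // _ _; move: (lcross s i) (lnest s i) => c d;
     case: (d == 0%N); rewrite /sel /= !(expr0, expr1, mulr1, mul1r); ring.
- case: ifP => // oi _.
  have ne : (s i == i) = false by rewrite -(inj_eq (@ord_inj N)) gtn_eqF.
  rewrite word_i ne oi record_upper // antirecord_upper //.
  have -> : s i \in [set x : 'I_N | (i < x)%N && ((s^-1)%g x <= i)%N].
    by rewrite inE gt_si permK leqnn.
  have -> : #|[set x in [set x : 'I_N | (i < x)%N && ((s^-1)%g x <= i)%N] | ord_gt (s i) x]| = ucross s i.
    by rewrite ucrossE; congr #|pred_of_set _|; apply/setP => x; rewrite !inE andbA.
  have -> : #|[set x in [set x : 'I_N | (i < x)%N && ((s^-1)%g x <= i)%N] | ord_gt x (s i)]| = unest s i.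
    by rewrite unestE //; congr #|pred_of_set _|; apply/setP => x; rewrite !inE andbA.
  have -> : chain_start [ffun j => s j] (above i) i = chain_start s (above i) i.
    by apply: eq_chain_start => j _; rewrite ffunE.
  rewrite -cycle_min_chain_start /arc_weight.
  (* A double rise has a smaller preimage, so among upper sources only valleys can be cycle
     minima. *)
  have nmin : ((s^-1)%g i < i)%N -> cycle_min s i = false.
    by move=> lt; apply/negP => /cycle_min_le[_]; rewrite leqNgt lt.
  move: Vne nmin; rewrite (gtn_eqF gt_si).
  case: (ltngtP ((s^-1)%g i) i) => // _ _; [move=> /(_ isT)-> | move=> _];
    move: (ucross s i) (unest s i) (cycle_min s i) => c d [];
    case: (d == 0%N);
    rewrite /sel /= !(expr0, expr1, mulr1, mul1r); ring.
move=> _; rewrite word_i si eqxx record_fix // antirecord_fix // perm_height //.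
rewrite cycle_min_fix // /fix_weight /sel.
have -> : ((s^-1)%g i = i) by rewrite -{1}si permK.
rewrite ltnn.
case: (psnest s i) => [|d]; case: odd_index; rewrite /= !(expr0, expr1, mulr1, mul1r); ring.
Qed.

Lemma Phat_words n :
  Phat x1 x2 y1 y2 u1 u2 v1 v2 we wo ze zo
    pm1 pm2 pp1 pp2 qm1 qm2 qp1 qp2 se so lam n =
  \sum_(t : (n.*2).-tuple letter | balanced_word (tnth t))
    \sum_f \prod_i weight (tnth t) i f.
Proof.
set N := n.*2; pose T := (N.-tuple letter * {ffun 'I_N -> 'I_N})%type.
pose ok (p : T) := balanced_word (tnth p.1) && [forall i, valid_at (tnth p.1) p.2 i].
transitivity (\sum_(p : T | ok p) \prod_i weight (tnth p.1) i p.2); last first.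
  transitivity (\sum_(t : N.-tuple letter | balanced_word (tnth t))
      \sum_(f : {ffun 'I_N -> 'I_N} | [forall i, valid_at (tnth t) f i])
        \prod_i weight (tnth t) i f); first by rewrite pair_big_dep.
  apply: eq_bigr => t _; rewrite big_mkcond; apply: eq_bigr => f _.
  case: ifPn => // /forallPn[i nvalid].
  by rewrite (bigD1 i) //= /weight index_weight_invalid // mul0r.
pose h (s : 'S_N) : T := ([tuple perm_word s i | i < N], [ffun i => s i]).
(* The default is never reached on pairs satisfying [ok], whose second component is a permutation by
   [valid_word]. *)
pose h' (p : T) : 'S_N := insubd (1%g : 'S_N) p.2.
have tnth_h s : tnth (h s).1 =1 perm_word s by move=> i; rewrite tnth_mktuple.
have hK s : h' (h s) = s.
  rewrite /h' /h /= (_ : [ffun i => s i] = val s) ?valKd //.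
  by apply/ffunP => i; rewrite ffunE -[val s]/(pval s) pvalE.
rewrite (reindex_onto h h') /=; last first.
  move=> [t f] /andP[_ /forallP valid_f].
  have [s [/= fE wE _]] := valid_word valid_f.
  have -> : (t, f) = h s.
    by rewrite fE; congr (_, _); apply: eq_from_tnth => i; rewrite tnth_h wE.
  by rewrite hK.
apply: eq_big => [s | s s_D].
  rewrite hK eqxx andbT; apply/forallP/andP => [s_D | [_ /forallP valid_s]].
    split; first by rewrite /balanced_word (eq_balanced _ _ (tnth_h s)); exact: perm_balanced.
    by apply/forallP => i; rewrite (eq_valid_at (tnth_h s)) perm_valid.
  have [s' [/ffunP fE _ s_D]] := valid_word valid_s.
  have ss' : s = s' by apply/permP => i; have := fE i; rewrite !ffunE.
  by rewrite ss'.
transitivity (\prod_i weight (perm_word s) i [ffun j => s j]); last first.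
  by apply: eq_bigr => i _; apply: eq_index_weight => j; rewrite tnth_h.
rewrite -card_cycle_min.
rewrite -(eq_bigr _ (fun i _ => local_weight i (forallP s_D))).
by rewrite !big_split /= -!expr_card -!expr_sum_if.
Qed.

End DPermutations.

(** * Matching the path recursion with the continued fraction *)

Lemma path_sum_two_steps (R : comNzRingType) (step : bool -> letter -> nat -> R) n h :
  path_sum step true n.+1.*2 h =
    step true (Some true) h *
      (step false (Some true) h.+1 * path_sum step true n.*2 h
       + (step false (Some false) h.+1 + step false None h.+1)
         * path_sum step true n.*2 h.+1)
    + (step true (Some false) h + step true None h) *
      (step false (Some true) h * path_sum step true n.*2 h.-1
       + (step false (Some false) h + step false None h)
         * path_sum step true n.*2 h).
Proof. by rewrite doubleS /= !big_letter /next_height /=; ring. Qed.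

Theorem theorem4p3 (R : comNzRingType)
    (x1 x2 y1 y2 u1 u2 v1 v2 we wo ze zo
     pm1 pm2 pp1 pp2 qm1 qm2 qp1 qp2 se so lam : R)
    (alpha delta : nat -> R)
    (hv1 : v1 = y1) (hqp1 : qp1 = pp1)
    (halpha_odd : forall k : nat, (1 <= k)%N ->
       alpha (2 * k - 1)%N =
         (lam + k%:R - 1) * pp1 ^+ (k - 1) * y1
         * (pm1 ^+ (k - 1) * x1 + qm1 * pqint (k - 1) pm1 qm1 * u1))
    (halpha_even : forall k : nat, (1 <= k)%N ->
       alpha (2 * k)%N =
         (pm2 ^+ (k - 1) * x2 + qm2 * pqint (k - 1) pm2 qm2 * u2
          + lam * se ^+ k * we)
         * (pp2 ^+ (k - 1) * y2 + qp2 * pqint (k - 1) pp2 qp2 * v2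
            + lam * so ^+ k * wo))
    (hdelta1 : delta 1%N = lam ^+ 2 * ze * zo)
    (hdelta : forall n : nat, (2 <= n)%N -> delta n = 0) :
  is_tfrac delta alpha
    (fun n : nat =>
       Phat x1 x2 y1 y2 u1 u2 v1 v2 we wo ze zo
         pm1 pm2 pp1 pp2 qm1 qm2 qp1 qp2 se so lam n).
Proof.
pose sel (a b : R) (v : bool) : R := if v then a else b.
pose step := step_weight (sel x1 x2) (sel u1 u2) (sel pm1 pm2) (sel qm1 qm2)
    (sel y1 y2) (sel v1 v2) (sel pp1 pp2) (sel qp1 qp2)
    (sel wo we) (sel zo ze) (sel so se) lam.
have step0 : step false (Some true) 0 = 0 by apply: arc_sum0.
have PhatE n : Phat x1 x2 y1 y2 u1 u2 v1 v2 we wo ze zo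
    pm1 pm2 pp1 pp2 qm1 qm2 qp1 qp2 se so lam n = path_sum step true n.*2 0.
  rewrite Phat_words -sum_balanced //; apply: eq_bigr => t bal.
  exact: sum_index_weight.
have fixS o h : fix_weight (sel wo we) (sel zo ze) (sel so se) lam o h.+1
    = lam * sel so se o ^+ h.+1 * sel wo we o.
  by rewrite /fix_weight /=; ring.
suff : is_tfrac delta alpha (fun n => path_sum step true n.*2 0).
  by move=> cvg n; have [N0 H] := cvg n; exists N0 => N leN; rewrite H // PhatE.
apply: (@tfrac_transfer R (step true (Some true)) (step false (Some true))
  (fun h => step false (Some false) h + step false None h)
  (fun h => step true (Some false) h + step true None h) delta alpha
  (fun n => path_sum step true n.*2)) => //.
- by move=> n h; apply: path_sum_two_steps.
(* The height before the valley is [h = k - 1], which turns $\lambda+k-1$ into $\lambda+h$. *)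
- move=> h; have := halpha_odd h.+1 isT.
  rewrite (_ : 2 * h.+1 - 1 = h.*2.+1)%N; last by lia.
  rewrite subSS subn0 => ->; rewrite /step /step_weight arc_sumS /sel -natr1.
  by rewrite -addrA addrK.
- move=> h; have := halpha_even h.+1 isT.
  rewrite (_ : 2 * h.+1 = h.*2.+2)%N; last by lia.
  by rewrite subSS subn0 => ->; rewrite /step /step_weight !arc_sumS !fixS.
by rewrite hdelta1 /step /step_weight !arc_sum0 /fix_weight /sel /=; ring.
Qed.
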